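(* Let $n\in\{2,3\}$. The principal level 2 congruence subgroup $\Gamma_n[2]$ of $\mathrm{GL}(n,\mathbb{Z})$ has a presentation with generating set $\{S_{ij},O_i\mid 1\leq i\neq j\leq n\}$ and the following defining relators, where in each relator the indices occurring lie in $\{1,\dots,n\}$, are pairwise different, and range over all such choices. For $n=2$: (1) $O_i^2$; (2) $[O_i,O_j]$; (3) $(O_iS_{ij})^2$; (4) $(O_jS_{ij})^2$. For $n=3$: (1) $O_i^2$; (2) $[O_i,O_j]$; (3) $(O_iS_{ij})^2$; (4) $(O_jS_{ij})^2$; (5) $[O_i,S_{jk}]$; (6) $[S_{ki},S_{kj}]$; (8) $[S_{ji},S_{ki}]$; (9) $[S_{kj},S_{ji}]S_{ki}^{-2}$; (10) $(S_{ij}S_{ik}^{-1}S_{ki}S_{ji}S_{jk}S_{kj}^{-1})^2$.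
   Context: $\Gamma_n[2]$ is the kernel of the homomorphism $\mathrm{GL}(n,\mathbb{Z})\to\mathrm{GL}(n,\mathbb{Z}/2)$ reducing matrix entries mod 2. For $i\neq j$, $S_{ij}\in\Gamma_n[2]$ is the matrix with $1$s on the diagonal, $2$ in the $(i,j)$ position and $0$s elsewhere. $O_i\in\Gamma_n[2]$ differs from the identity matrix only in having $-1$ in the $(i,i)$ position. Write $[g,h]=ghg^{-1}h^{-1}$. *)

(* Defs.v *)
From HB Require Import structures.
From mathcomp Require Import all_boot all_order all_algebra.

Set Implicit Arguments.
Unset Strict Implicit.
Unset Printing Implicit Defensive.

Import GRing.Theory.
Local Open Scope group_scope.

(* Elements of the free group on X are freely reduced words; the letter (x, b)
   stands for x if b = false and for the formal inverse of x if b = true. *)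

Section FreeReduction.
Variable X : choiceType.
Implicit Types (a b : X * bool) (s t u : seq (X * bool)).

Definition linv a := (a.1, ~~ a.2).

Definition reduced s := sorted (fun a b => b != linv a) s.

(* The reduced form of a :: s, for s reduced. *)
Definition lmul a s :=
  if s is b :: s' then if b == linv a then s' else a :: s else [:: a].

Definition wmul s t := foldr lmul t s.
Definition winv s := rev (map linv s).

Lemma linvK : involutive linv.
Proof. by case=> x b; rewrite /linv /= negbK. Qed.

Lemma reduced_lmul a s : reduced s -> reduced (lmul a s).
Proof.
case: s => [//|b s] /= bs; case: ifP => [_|/negbT ba]; first exact: path_sorted bs.
by rewrite /= ba.
Qed.

Lemma lmulVK a s : reduced s -> lmul (linv a) (lmul a s) = s.
Proof.
case: s => [_|b s /= bs] /=; first by rewrite linvK eqxx.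
case: ifP => [/eqP ba|_] /=; last by rewrite linvK eqxx.
case: s bs => [|c s] /=; first by rewrite ba.
by rewrite ba linvK => /andP[/negPf-> _].
Qed.

Lemma reduced_wmul s t : reduced t -> reduced (wmul s t).
Proof. by move=> rt; elim: s => //= a s; apply: reduced_lmul. Qed.

Lemma lmul_wmul a s t : reduced s -> reduced t ->
  wmul (lmul a s) t = lmul a (wmul s t).
Proof.
case: s => [//|b s] /= _ rt; case: ifP => [/eqP ba|//]; rewrite ?ba.
by rewrite -{1}(linvK a) lmulVK //; apply: reduced_wmul.
Qed.

Lemma wmulA s t u : reduced t -> reduced u ->
  wmul s (wmul t u) = wmul (wmul s t) u.
Proof.
move=> rt ru; elim: s => //= a s IHs.
by rewrite IHs lmul_wmul //; apply: reduced_wmul.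
Qed.

Lemma wmul1 s : reduced s -> wmul s [::] = s.
Proof.
elim: s => //= a s IHs as_; rewrite IHs; last exact: path_sorted as_.
by case: s as_ {IHs} => //= b s /andP[/negPf->].
Qed.

Lemma reduced_winv s : reduced s -> reduced (winv s).
Proof.
rewrite /reduced rev_sorted sorted_map; apply: sub_sorted => a b /=.
by rewrite linvK; apply: contraNneq => ->.
Qed.

Lemma wmulVK s t : reduced t -> wmul (winv s) (wmul s t) = t.
Proof.
elim: s t => //= a s IHs t rt; rewrite /winv /= rev_cons -cats1 {1}/wmul foldr_cat /=.
by rewrite lmulVK ?reduced_wmul //; apply: IHs.
Qed.

Lemma wmulV s : reduced s -> wmul (winv s) s = [::].
Proof. by move=> rs; rewrite -{2}(wmul1 rs) wmulVK. Qed.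

Lemma winvK : involutive winv.
Proof. by move=> s; rewrite /winv map_rev revK mapK //; apply: linvK. Qed.

End FreeReduction.

Record free_group (X : choiceType) :=
  FreeGroup { fgword :> seq (X * bool); fgword_reduced : reduced fgword }.
Arguments FreeGroup {X} fgword fgword_reduced.

HB.instance Definition _ X := [isSub for @fgword X].
HB.instance Definition _ X := [Choice of free_group X by <:].

Section FreeGroupTheory.
Variable X : choiceType.
Implicit Types v w : free_group X.

Definition fgone : free_group X := FreeGroup [::] isT.
Definition fgmul v w : free_group X :=
  FreeGroup (wmul v w) (reduced_wmul v (fgword_reduced w)).
Definition fginv v : free_group X :=
  FreeGroup (winv v) (reduced_winv (fgword_reduced v)).

Lemma fgmulA : associative fgmul.
Proof. by move=> u v w; apply/val_inj/wmulA; apply: fgword_reduced. Qed.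
Lemma fgmul1g : left_id fgone fgmul.
Proof. by move=> w; apply/val_inj. Qed.
Lemma fgmulg1 : right_id fgone fgmul.
Proof. by move=> w; apply/val_inj/wmul1/fgword_reduced. Qed.
Lemma fgmulVg : left_inverse fgone fginv fgmul.
Proof. by move=> w; apply/val_inj/wmulV/fgword_reduced. Qed.
Lemma fgmulgV : right_inverse fgone fginv fgmul.
Proof.
move=> w; apply/val_inj; rewrite /= -{1}(winvK w).
exact/wmulV/reduced_winv/fgword_reduced.
Qed.

HB.instance Definition _ :=
  isGroup.Build (free_group X) fgmulA fgmul1g fgmulg1 fgmulVg fgmulgV.

Definition fggen (x : X) : free_group X := FreeGroup [:: (x, false)] isT.

End FreeGroupTheory.

Section FreeGroupLift.
Variables (X : choiceType) (G : groupType) (f : X -> G).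
Implicit Types v w : free_group X.

Definition letter_eval (a : X * bool) : G := if a.2 then (f a.1)^-1 else f a.1.

Definition fglift w : G := \prod_(a <- fgword w) letter_eval a.

Lemma letter_evalV a : letter_eval (linv a) = (letter_eval a)^-1.
Proof. by case: a => x [] //=; rewrite /letter_eval /= invgK. Qed.

Lemma fglift_mul : {morph fglift : v w / v * w}.
Proof.
move=> v w; rewrite /fglift /=; elim: (fgword v) => [|a s IHs].
  by rewrite big_nil mul1g.
rewrite big_cons -mulgA -IHs /=; case: (wmul s w) => [|b t] /=.
  by rewrite big_cons big_nil.
case: ifP => [/eqP->|_]; rewrite !big_cons //.
by rewrite letter_evalV mulVKg.
Qed.

Lemma fglift1 : fglift 1 = 1.
Proof. by rewrite /fglift big_nil. Qed.

HB.instance Definition _ :=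
  isUMagmaMorphism.Build (free_group X) G fglift (fglift1, fglift_mul).

Lemma fglift_gen x : fglift (fggen x) = f x.
Proof. by rewrite /fglift big_seq1. Qed.

Lemma fglift_unique (h : UMagmaMorphism.type (free_group X) G) :
  (forall x, h (fggen x) = f x) -> h =1 fglift.
Proof.
move=> hf [s rs]; rewrite /fglift /=; elim: s rs => [|[x b] s IHs] rs.
  by rewrite big_nil -(gmulf1 (s := h)); congr (h _); apply: val_inj.
have rs' : reduced s := path_sorted rs.
rewrite big_cons -(IHs rs').
have -> : FreeGroup _ rs =
    (if b then (fggen x)^-1 else fggen x) * FreeGroup s rs'.
  apply/val_inj; case: b s rs {IHs} rs' => [] [|c s] //= /andP[+ _] _.
    by move=> /negPf; rewrite /linv /= => ->.
  by move=> /negPf ->.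
by rewrite gmulfM; congr (_ * _); case: b {rs}; rewrite ?gmulfV hf.
Qed.

End FreeGroupLift.

Inductive normal_closure (G : groupType) (R : G -> Prop) : G -> Prop :=
| ncl_rel r of R r : normal_closure R r
| ncl_one : normal_closure R 1
| ncl_mul g h of normal_closure R g & normal_closure R h :
    normal_closure R (g * h)
| ncl_inv g of normal_closure R g : normal_closure R g^-1
| ncl_conj g h of normal_closure R h : normal_closure R (g * h * g^-1).

(* The generators e x : G, x : X, and the relators R are a presentation of G:
   the homomorphism from the free group on X to G extending e is onto, and its
   kernel is the normal closure of R. *)
Definition is_presentation (X : choiceType) (G : groupType) (e : X -> G)
    (R : free_group X -> Prop) : Prop :=
  (forall g : G, exists w, fglift e w = g) /\
  (forall w, fglift e w = 1 <-> normal_closure R w).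

(* mathcomp's [~ g, h] is g^-1 * h^-1 * g * h. *)
Definition comm (G : groupType) (g h : G) : G := g * h * g^-1 * h^-1.

Record GL (n : nat) (R : comUnitRingType) :=
  MkGL { glmx :> 'M[R]_n; glmx_unit : glmx \in unitmx }.

HB.instance Definition _ n R := [isSub for @glmx n R].
HB.instance Definition _ n R := [Choice of GL n R by <:].

Section GLGroup.
Variables (n : nat) (R : comUnitRingType).
Implicit Types g h : GL n R.

Lemma glmul_unit g h : (g *m h)%R \in unitmx.
Proof. by rewrite unitmx_mul !glmx_unit. Qed.
Lemma glinv_unit g : invmx g \in unitmx.
Proof. by rewrite unitmx_inv glmx_unit. Qed.

Definition glone : GL n R := MkGL (unitmx1 R n).
Definition glmul g h : GL n R := MkGL (glmul_unit g h).
Definition glinv g : GL n R := MkGL (glinv_unit g).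

Lemma glmulA : associative glmul.
Proof. by move=> f g h; apply/val_inj/mulmxA. Qed.
Lemma glmul1g : left_id glone glmul.
Proof. by move=> g; apply/val_inj/mul1mx. Qed.
Lemma glmulg1 : right_id glone glmul.
Proof. by move=> g; apply/val_inj/mulmx1. Qed.
Lemma glmulVg : left_inverse glone glinv glmul.
Proof. by move=> g; apply/val_inj/mulVmx/glmx_unit. Qed.
Lemma glmulgV : right_inverse glone glinv glmul.
Proof. by move=> g; apply/val_inj/mulmxV/glmx_unit. Qed.

HB.instance Definition _ :=
  isGroup.Build (GL n R) glmulA glmul1g glmulg1 glmulVg glmulgV.

End GLGroup.

Section LevelTwo.
Variable n : nat.
Implicit Types g h : GL n int.

Lemma mod2_unit g : map_mx (intr : int -> 'Z_2) g \in unitmx.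
Proof. by rewrite unitmxE det_map_mx rmorph_unit // -unitmxE glmx_unit. Qed.

Definition mod2 g : GL n 'Z_2 := MkGL (mod2_unit g).

Lemma mod2_1 : mod2 1 = 1.
Proof. exact/val_inj/map_mx1. Qed.
Lemma mod2M : {morph mod2 : g h / g * h}.
Proof. by move=> g h; apply/val_inj/map_mxM. Qed.

HB.instance Definition _ :=
  isUMagmaMorphism.Build (GL n int) (GL n 'Z_2) mod2 (mod2_1, mod2M).

Definition ker_mod2 : {pred GL n int} := [pred g | mod2 g == 1].

Lemma ker_mod2_closed : group_closed ker_mod2.
Proof.
split=> [|g h]; rewrite !inE ?gmulf1 // => /eqP g1 /eqP h1.
by rewrite gmulfF /= g1 h1 divg1.
Qed.

Record Gamma2 := MkGamma2 { gammamx :> GL n int; _ : gammamx \in ker_mod2 }.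

HB.instance Definition _ := [isSub for gammamx].
HB.instance Definition _ := [Choice of Gamma2 by <:].
HB.instance Definition _ :=
  SubChoice_isSubGroup.Build (GL n int) ker_mod2 Gamma2 ker_mod2_closed.

Definition Smx (i j : 'I_n) : 'M[int]_n := (1%:M + 2 *: delta_mx i j)%R.
Definition Omx (i : 'I_n) : 'M[int]_n := (1%:M - 2 *: delta_mx i i)%R.

Lemma Smx_unit i j : i != j -> Smx i j \in unitmx.
Proof.
move=> ij; have /mulmx1_unit[] // : (Smx i j *m (1%:M - 2 *: delta_mx i j) = 1%:M)%R.
rewrite /Smx mulmxBr mulmx1 mulmxDl mul1mx -scalemxAl -scalemxAr.
by rewrite mul_delta_mx_0 1?eq_sym // !scaler0 addr0 addrK.
Qed.

Lemma Omx_unit i : Omx i \in unitmx.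
Proof.
have /mulmx1_unit[] // : (Omx i *m Omx i = 1%:M)%R.
have OE : (Omx i *m delta_mx i i = - delta_mx i i)%R.
  rewrite mulmxBl mul1mx -scalemxAl mul_delta_mx scaler_nat mulr2n.
  by rewrite opprD addrA subrr sub0r.
by rewrite {2}/Omx mulmxBr mulmx1 -scalemxAr OE scalerN opprK subrK.
Qed.

Lemma Smx_mod2 i j (ij : i != j) : MkGL (Smx_unit ij) \in ker_mod2.
Proof.
rewrite inE -val_eqE /=; apply/eqP/matrixP => a b.
by rewrite !mxE rmorphD rmorphM /= (_ : 2%:~R = 0)%R ?mul0r ?addr0 ?rmorph_nat //; apply/val_inj.
Qed.

Lemma Omx_mod2 i : MkGL (Omx_unit i) \in ker_mod2.
Proof.
rewrite inE -val_eqE /=; apply/eqP/matrixP => a b.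
by rewrite !mxE rmorphB rmorphM /= (_ : 2%:~R = 0)%R ?mul0r ?subr0 ?rmorph_nat //; apply/val_inj.
Qed.

Definition Selt (i j : 'I_n) (ij : i != j) : Gamma2 := MkGamma2 (Smx_mod2 ij).
Definition Oelt (i : 'I_n) : Gamma2 := MkGamma2 (Omx_mod2 i).

(* The index set of the generators: pairs i != j for the S_ij, then the O_i. *)
Definition gen : choiceType := ({ij : 'I_n * 'I_n | ij.1 != ij.2} + 'I_n)%type.

Definition gen_elt (x : gen) : Gamma2 :=
  match x with inl ij => Selt (valP ij) | inr i => Oelt i end.

Definition Sgen (i j : 'I_n) (ij : i != j) : free_group gen :=
  fggen (inl (exist _ (i, j) ij) : gen).
Definition Ogen (i : 'I_n) : free_group gen := fggen (inr i : gen).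

Inductive relators2 : free_group gen -> Prop :=
| rel_Oi i : relators2 (Ogen i ^+ 2)
| rel_Oi_Oj (i j : 'I_n) (ij : i != j) : relators2 (comm (Ogen i) (Ogen j))
| rel_Oi_Sij (i j : 'I_n) (ij : i != j) : relators2 ((Ogen i * Sgen ij) ^+ 2)
| rel_Oj_Sij (i j : 'I_n) (ij : i != j) : relators2 ((Ogen j * Sgen ij) ^+ 2).

Inductive relators3 : free_group gen -> Prop :=
| rel_relators2 w of relators2 w : relators3 w
| rel_Oi_Sjk (i j k : 'I_n) (ij : i != j) (ik : i != k) (jk : j != k) :
    relators3 (comm (Ogen i) (Sgen jk))
| rel_Ski_Skj (i j k : 'I_n) (ij : i != j) (ki : k != i) (kj : k != j) :
    relators3 (comm (Sgen ki) (Sgen kj))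
| rel_Sji_Ski (i j k : 'I_n) (ji : j != i) (ki : k != i) (jk : j != k) :
    relators3 (comm (Sgen ji) (Sgen ki))
| rel_Skj_Sji (i j k : 'I_n) (kj : k != j) (ji : j != i) (ki : k != i) :
    relators3 (comm (Sgen kj) (Sgen ji) * Sgen ki ^- 2)
| rel_square (i j k : 'I_n) (ij : i != j) (ik : i != k) (ki : k != i)
    (ji : j != i) (jk : j != k) (kj : k != j) :
    relators3 ((Sgen ij * (Sgen ik)^-1 * Sgen ki * Sgen ji * Sgen jk
                * (Sgen kj)^-1) ^+ 2).

End LevelTwo.

(* Main.v *)
Require Import Defs.
From HB Require Import structures.
From mathcomp Require Import all_boot all_order all_algebra.
From mathcomp Require Import generic_quotient boolp.
From mathcomp Require Import zify ring.

(** By induction on n <= 3.  Let Q be a group generated by elements satisfying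
    the relations and mapping onto Gamma_n[2].  It acts on the first rows,
    which are primitive integral vectors congruent to e_0 mod 2.  Call an
    element of Q climbing if it is a word along which the l^1 norm of the first
    row increases, up to sign changes.  Peak reduction, by induction on the
    norm, shows that climbing elements with the same first row lie in the same
    right coset of the subgroup generated by the generators fixing e_0: the
    relations (3)-(9) connect any two descents from a row through smaller rows,
    except when the two even entries p, q agree and are smaller than the odd
    entry r.  Then the descents reach the same row, and one needs
    t = S_pr S_qr^-1 to be in the coset stabilizer of that row.  Conjugating t
    by g = S_rp S_rq brings it to a smaller row; with u = S_pq^-1 S_qp, which
    inverts g and t, relator (10) reads (g t u)^2 = 1, that is
    g t g^-1 = u^-2 t.  So every element climbs, the kernel lies in the subgroup
    of generators fixing e_0, and this is the product of the translations
    S_i0 and the group for n - 1. *)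

Set Implicit Arguments.
Unset Strict Implicit.
Unset Printing Implicit Defensive.

Import GRing.Theory.
Local Open Scope group_scope.

(** * Groups defined by relators *)

Section QuotientGroup.
Local Open Scope quotient_scope.
Variables (X : choiceType) (R : free_group X -> Prop).
Implicit Types v w : free_group X.

Definition ncl_eq v w := `[< normal_closure R (v / w) >].

Lemma ncl_eq_equiv : equiv_class_of ncl_eq.
Proof.
split=> [v|v w|w v u].
- by apply/asboolP; rewrite mulgV; apply: ncl_one.
- by apply/asboolP/asboolP => h; rewrite -invgF; apply: ncl_inv.
- move=> /asboolP h1 /asboolP h2; apply/asboolP.
  by rewrite -(divgKA w); apply: ncl_mul.
Qed.

Canonical ncl_equiv_rel := EquivRelPack ncl_eq_equiv.

Definition ncl_quot := {eq_quot ncl_eq}.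
HB.instance Definition _ := Choice.on ncl_quot.
HB.instance Definition _ := EqQuotient.on ncl_quot.

Lemma ncl_piP v w : reflect (\pi_ncl_quot v = \pi w) (ncl_eq v w).
Proof. exact: eqmodP. Qed.

Definition ncl_one_quot : ncl_quot := \pi_ncl_quot (1 : free_group X).
Definition ncl_mul_quot (x y : ncl_quot) : ncl_quot := \pi_ncl_quot (repr x * repr y).
Definition ncl_inv_quot (x : ncl_quot) : ncl_quot := \pi_ncl_quot (repr x)^-1.

Lemma ncl_repr_pi w : normal_closure R (repr (\pi_ncl_quot w) / w).
Proof. by apply/asboolP/ncl_piP; rewrite reprK. Qed.

Lemma ncl_piM v w : \pi_ncl_quot (v * w) = ncl_mul_quot (\pi v) (\pi w).
Proof.
apply/esym/ncl_piP/asboolP; set v' := repr _; set w' := repr _.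
have -> : v' * w' / (v * w) = (v' / v) * (v * (w' / w) * v^-1).
  by rewrite invgM !mulgA mulgVK.
by apply: ncl_mul; last apply: ncl_conj; apply: ncl_repr_pi.
Qed.

Lemma ncl_piV v : \pi_ncl_quot v^-1 = ncl_inv_quot (\pi v).
Proof.
apply/ncl_piP/asboolP; set v' := repr _.
have -> : v^-1 / v'^-1 = v^-1 * (v' / v) * v^-1^-1 by rewrite !invgK mulgA mulgVK.
by apply/ncl_conj/ncl_repr_pi.
Qed.

Lemma ncl_quot_mulA : associative ncl_mul_quot.
Proof. by elim/quotW=> u; elim/quotW=> v; elim/quotW=> w; rewrite -!ncl_piM mulgA. Qed.
Lemma ncl_quot_mul1 : left_id ncl_one_quot ncl_mul_quot.
Proof. by elim/quotW=> u; rewrite -ncl_piM mul1g. Qed.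
Lemma ncl_quot_1mul : right_id ncl_one_quot ncl_mul_quot.
Proof. by elim/quotW=> u; rewrite -ncl_piM mulg1. Qed.
Lemma ncl_quot_mulV : left_inverse ncl_one_quot ncl_inv_quot ncl_mul_quot.
Proof. by elim/quotW=> u; rewrite -ncl_piV -ncl_piM mulVg. Qed.
Lemma ncl_quot_Vmul : right_inverse ncl_one_quot ncl_inv_quot ncl_mul_quot.
Proof. by elim/quotW=> u; rewrite -ncl_piV -ncl_piM mulgV. Qed.

HB.instance Definition _ := isGroup.Build ncl_quot
  ncl_quot_mulA ncl_quot_mul1 ncl_quot_1mul ncl_quot_mulV ncl_quot_Vmul.

Definition ncl_pi (w : free_group X) : ncl_quot := \pi_ncl_quot w.

Lemma ncl_pi_mul : {morph ncl_pi : v w / v * w}.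
Proof. exact: ncl_piM. Qed.

HB.instance Definition _ := isUMagmaMorphism.Build (free_group X) ncl_quot
  ncl_pi (erefl, ncl_pi_mul).

Lemma ncl_pi_eq1 w : ncl_pi w = 1 <-> normal_closure R w.
Proof.
split=> [/ncl_piP/asboolP|h]; first by rewrite divg1.
by apply/ncl_piP/asboolP; rewrite divg1.
Qed.

End QuotientGroup.

Lemma normal_closure_lift (X : choiceType) (G : groupType) (e : X -> G)
    (R : free_group X -> Prop) w :
  (forall r, R r -> fglift e r = 1) -> normal_closure R w -> fglift e w = 1.
Proof.
move=> eR; elim=> {w} [w /eR//||v w _ v1 _ w1|v _ v1|v w _ w1].
- by rewrite gmulf1.
- by rewrite gmulfM /= v1 w1 mulg1.
- by rewrite gmulfV /= v1 invg1.
- by rewrite !gmulfM gmulfV /= w1 mulg1 mulgV.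
Qed.

Lemma presentation_from_quotients (X : choiceType) (G : groupType) (e : X -> G)
    (R : free_group X -> Prop) :
  (forall g, exists w, fglift e w = g) ->
  (forall r, R r -> fglift e r = 1) ->
  (forall (Q : groupType) (f : X -> Q) (phi : Q -> G),
     {morph phi : x y / x * y} -> (forall x, phi (f x) = e x) ->
     (forall r, R r -> fglift f r = 1) ->
     forall w, fglift e w = 1 -> fglift f w = 1) ->
  is_presentation e R.
Proof.
move=> esurj eR univ; split=> // w; split; last exact: normal_closure_lift.
pose f x := ncl_pi R (fggen x).
have fE v : fglift f v = ncl_pi R v.
  by apply/esym; apply: (fglift_unique (h := ncl_pi R)).
(* Evaluation on chosen representatives; independence of the choice is [phi_pi], which needs that
   the relators hold in [G]. *)
pose phi (q : ncl_quot R) := fglift e (repr q).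
have phi_pi v : phi (ncl_pi R v) = fglift e v.
  have := normal_closure_lift eR (ncl_repr_pi R v).
  by rewrite gmulfF => /divg1_eq.
move=> w1; apply/ncl_pi_eq1; rewrite -fE; apply: (univ _ _ phi) => //.
- by elim/quotW=> u; elim/quotW=> v; rewrite -[_ * _]ncl_piM !phi_pi gmulfM.
- by move=> x; rewrite phi_pi fglift_gen.
- by move=> r Rr; rewrite fE; apply/ncl_pi_eq1/ncl_rel.
Qed.

(** * Entries of matrices and relations *)

Section GammaEntries.
Variable n : nat.
Implicit Types (x y : Gamma2 n) (i j k r c : 'I_n).

Definition entry x r c : int := (x : GL n int) r c.

Lemma entry_inj x y : (forall r c, entry x r c = entry y r c) -> x = y.
Proof. by move=> xy; do 2!apply/val_inj => /=; apply/matrixP. Qed.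

Lemma entryM x y r c : entry (x * y) r c = (\sum_k entry x r k * entry y k c)%R.
Proof. by rewrite /entry /= mxE. Qed.

Lemma entry1 r c : entry 1 r c = (r == c)%:R%R.
Proof. by rewrite /entry /= mxE. Qed.

Lemma entry_mod2 x r c : exists z : int, (entry x r c = (r == c)%:R + 2 * z)%R.
Proof.
case: x => x xk; rewrite /entry /=; move: xk; rewrite inE -val_eqE.
move=> /eqP/matrixP/(_ r c); rewrite !mxE; move: (fun_of_matrix _ r c) => a xrc.
have aE : (a = (a %/ 2)%Z * 2 + (a %% 2)%Z)%R := divz_eq a 2.
have a2 : (0 <= (a %% 2)%Z < 2)%R by rewrite modz_ge0 //= ltz_mod.
move: xrc aE a2; move: (a %/ 2)%Z (a %% 2)%Z => q z xrc aE z2; rewrite {}aE in xrc *; move: xrc.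
have two0 : (2%:~R = 0 :> 'Z_2)%R by apply/val_inj.
rewrite rmorphD rmorphM /= two0 mulr0 add0r => zrc; exists q; rewrite addrC mulrC.
congr (_ + _)%R; move: z z2 zrc => [[|[|z]]|z] //= _; case: (r == c) => //.
Qed.

Lemma entry_mulS x i j (ij : i != j) r c :
  entry (x * Selt ij) r c =
    (if c == j then entry x r c + 2 * entry x r i else entry x r c)%R.
Proof.
rewrite /entry /= /Smx mulmxDr mulmx1 -scalemxAr !mxE (bigD1 i) //= big1 => [|k ki].
  rewrite !mxE eqxx addr0 /=; case: eqP => _; first by rewrite mulr1.
  by rewrite mulr0 mulr0 addr0.
by rewrite mxE (negPf ki) mulr0.
Qed.

Lemma entry_mulO x i r c :
  entry (x * Oelt i) r c = (if c == i then - entry x r c else entry x r c)%R.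
Proof.
rewrite /entry /= /Omx mulmxBr mulmx1 -scalemxAr !mxE (bigD1 i) //= big1 => [|k ki].
  rewrite !mxE eqxx addr0 /=; case: eqP => [->|_]; first by rewrite mulr1; ring.
  by rewrite mulr0 mulr0 subr0.
by rewrite mxE (negPf ki) mulr0.
Qed.

End GammaEntries.

(* [S i i] is a junk value. *)
Record relations3 (n : nat) (Q : groupType) (S : 'I_n -> 'I_n -> Q)
    (O : 'I_n -> Q) : Prop := Relations3 {
  relO2 : forall i, O i * O i = 1;
  relOO : forall i j, i != j -> O i * O j = O j * O i;
  relOSi : forall i j, i != j -> O i * S i j * O i = (S i j)^-1;
  relOSj : forall i j, i != j -> O j * S i j * O j = (S i j)^-1;
  relOS : forall i j k, i != j -> i != k -> j != k -> O i * S j k = S j k * O i;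
  relSrow : forall i j k, i != j -> k != i -> k != j -> S k i * S k j = S k j * S k i;
  relScol : forall i j k, j != i -> k != i -> j != k -> S j i * S k i = S k i * S j i;
  relSS : forall i j k, k != j -> j != i -> k != i ->
    comm (S k j) (S j i) = S k i ^+ 2;
  relsq : forall i j k, i != j -> i != k -> j != k ->
    (S i j * (S i k)^-1 * S k i * S j i * S j k * (S k j)^-1) ^+ 2 = 1
}.

Section GenVal.
Variables (n : nat) (Q : groupType).

Definition gen_val (S : 'I_n -> 'I_n -> Q) (O : 'I_n -> Q) (x : gen n) : Q :=
  match x with inl ij => S (val ij).1 (val ij).2 | inr i => O i end.

(** Makes the off-diagonal generators a total function of two indices, with default 1 on the
    diagonal. *)
Definition Sval (f : gen n -> Q) (i j : 'I_n) : Q :=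
  if insub (i, j) is Some ij then f (inl ij) else 1.

Lemma gen_valE f : f = gen_val (Sval f) (fun i => f (inr i)).
Proof. by apply/funext; case=> [[[i j] ij]|i] //=; rewrite /Sval insubT /=; congr (f (inl _)); apply/val_inj. Qed.

Lemma Sval_neq f i j (ij : i != j) : Sval f i j = f (inl (exist _ (i, j) ij)).
Proof. by rewrite /Sval insubT /=; congr (f (inl _)); apply/val_inj. Qed.

(** Passes from words in the free group to equations in [Q]. Since each [O i] is an involution,
    relators (3) and (4) say that conjugation by it inverts the letter. *)
Lemma relators3P (S : 'I_n -> 'I_n -> Q) (O : 'I_n -> Q) :
  (forall r, relators3 r -> fglift (gen_val S O) r = 1) <-> relations3 S O.
Proof.
set f := gen_val S O.
have fO i : fglift f (Ogen i) = O i by rewrite fglift_gen.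
have fS i j (ij : i != j) : fglift f (Sgen ij) = S i j by rewrite fglift_gen.
have comm_eq (g h : Q) : comm g h = 1 <-> g * h = h * g.
  rewrite /comm; split=> [|->]; last by rewrite mulgK mulgV.
  by rewrite -mulgA -invgM => /divg1_eq.
have fcomm v w : fglift f (comm v w) = comm (fglift f v) (fglift f w).
  by rewrite /comm !gmulfM !gmulfV.
have invol (o s : Q) : o * o = 1 -> (o * s) ^+ 2 = 1 <-> o * s * o = s^-1.
  move=> oo; rewrite expg2 mulgA; split=> [|->]; last exact: mulVg.
  by move=> /(canRL (mulgK _)); rewrite mul1g.
split=> [fR|[r1 r2 r3 r4 r5 r6 r7 r8 r9] r].
  have fR2 r : relators2 r -> fglift f r = 1 by move=> r2; apply/fR/rel_relators2.
  have oo i : O i * O i = 1.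
    by have /fR2 := rel_Oi i; rewrite gmulfXn /= fO.
  split=> //.
  - by move=> i j ij; apply/comm_eq; have /fR2 := rel_Oi_Oj ij; rewrite fcomm !fO.
  - move=> i j ij; apply/invol => //; have /fR2 := rel_Oi_Sij ij.
    by rewrite gmulfXn gmulfM /= fO fS.
  - move=> i j ij; apply/invol => //; have /fR2 := rel_Oj_Sij ij.
    by rewrite gmulfXn gmulfM /= fO fS.
  - move=> i j k ij ik jk; apply/comm_eq; have /fR := rel_Oi_Sjk ij ik jk.
    by rewrite fcomm fO fS.
  - move=> i j k ij ki kj; apply/comm_eq; have /fR := rel_Ski_Skj ij ki kj.
    by rewrite fcomm !fS.
  - move=> i j k ji ki jk; apply/comm_eq; have /fR := rel_Sji_Ski ji ki jk.
    by rewrite fcomm !fS.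
  - move=> i j k kj ji ki; have /fR := rel_Skj_Sji kj ji ki.
    by rewrite gmulfF /= fcomm gmulfXn /= !fS => /divg1_eq.
  - move=> i j k ij ik jk; have ki := ik; have ji := ij; have kj := jk.
    rewrite eq_sym in ki; rewrite eq_sym in ji; rewrite eq_sym in kj.
    have /fR := rel_square ij ik ki ji jk kj.
    by rewrite gmulfXn !gmulfM !gmulfV /= !fS.
case=> [w|i j k ij ik jk|i j k ij ki kj|i j k ji ki jk|i j k kj ji ki|i j k ij ik ki ji jk kj].
- case=> [i|i j ij|i j ij|i j ij].
  + by rewrite gmulfXn /= fO; apply: r1.
  + by rewrite fcomm !fO; apply/comm_eq/r2.
  + by rewrite gmulfXn gmulfM /= fO fS; apply/invol => //; apply: r3.
  + by rewrite gmulfXn gmulfM /= fO fS; apply/invol => //; apply: r4.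
- by rewrite fcomm fO fS; apply/comm_eq/r5.
- by rewrite fcomm !fS; apply/comm_eq/r6.
- by rewrite fcomm !fS; apply/comm_eq/r7.
- by rewrite gmulfF /= fcomm gmulfXn /= !fS r8 // mulgV.
- by rewrite gmulfXn !gmulfM !gmulfV /= !fS; apply: r9.
Qed.

End GenVal.

Section GammaRelations.
Variable n : nat.
Implicit Types (x y : Gamma2 n) (i j k r c : 'I_n).

Let S := Sval (@gen_elt n).
Let O := @Oelt n.

Lemma entry_mulSval x i j : i != j -> forall r c, entry (x * S i j) r c =
  (if c == j then entry x r c + 2 * entry x r i else entry x r c)%R.
Proof. by move=> ij r c; rewrite /S (Sval_neq _ ij) entry_mulS. Qed.

Lemma entry_mulSvalV x i j : i != j -> forall r c, entry (x * (S i j)^-1) r c =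
  (if c == j then entry x r c - 2 * entry x r i else entry x r c)%R.
Proof.
move=> ij r c; have := entry_mulSval (x * (S i j)^-1) ij r.
rewrite mulgVK => E; have := E i; have := E c; rewrite (negPf ij).
by case: eqP => // _ -> <-; ring.
Qed.

(** With a generic left factor [g], each letter becomes a column operation on [g], so relations are
    checked without expanding matrix products. *)
Lemma gamma_eq x y : (forall g r c, entry (g * x) r c = entry (g * y) r c) -> x = y.
Proof. by move=> xy; apply/entry_inj => r c; rewrite -[x]mul1g xy mul1g. Qed.

Lemma gamma_relations : relations3 S O.
Proof.
have D i j : i != j -> ((i == j) = false) * ((j == i) = false).
  by move=> /negPf ij; split; rewrite // eq_sym.
have SE := entry_mulSval; have VE := entry_mulSvalV.
split.
- move=> i; apply: gamma_eq => g r c; rewrite mulgA !entry_mulO mulg1.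
  by case: (c == i); rewrite ?opprK.
- move=> i j ij; apply: gamma_eq => g r c; rewrite !mulgA !entry_mulO.
  by case: (eqVneq c i) => [->|]; rewrite ?(D _ _ ij).
- move=> i j ij; apply: gamma_eq => g r c; rewrite !mulgA !(SE, VE, entry_mulO) //.
  by rewrite ?eqxx ?(D _ _ ij); case: (eqVneq c i) => [->|]; rewrite ?(D _ _ ij) ?opprK // mulrN.
- move=> i j ij; apply: gamma_eq => g r c; rewrite !mulgA !(SE, VE, entry_mulO) //.
  by rewrite ?eqxx ?(D _ _ ij); case: (eqVneq c j) => // ->; ring.
- move=> i j k ij ik jk; apply: gamma_eq => g r c; rewrite !mulgA !(SE, VE, entry_mulO) //.
  by rewrite ?(D _ _ ij); case: (eqVneq c i) => [->|//]; rewrite ?(D _ _ ik).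
- move=> i j k ij ki kj; apply: gamma_eq => g r c; rewrite !mulgA !(SE, VE, entry_mulO) //.
  rewrite ?(D _ _ ki) ?(D _ _ kj); case: (eqVneq c i) => [->|//]; by rewrite ?(D _ _ ij).
- move=> i j k ji ki jk; apply: gamma_eq => g r c; rewrite !mulgA !(SE, VE, entry_mulO) //.
  rewrite ?(D _ _ ki) ?(D _ _ ji); case: (eqVneq c i) => // _; ring.
- move=> i j k kj ji ki; apply: gamma_eq => g r c.
  rewrite /comm expg2 !mulgA !(SE, VE) //.
  rewrite ?eqxx ?(D _ _ ki) ?(D _ _ ji) ?(D _ _ kj); case: (eqVneq c i) => [->|//].
    by rewrite ?eqxx ?(D _ _ ki) ?(D _ _ ji) ?(D _ _ kj); ring.
  by case: (eqVneq c j) => [->|//] _; ring.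
- move=> i j k ij ik jk; set Y := _ * _ * _ * _ * _ * _.
  have ki : k != i by rewrite eq_sym.
  have ji : j != i by rewrite eq_sym.
  have kj : k != j by rewrite eq_sym.
  (* The word squared in relator (10), as an operation on columns [i], [j], [k]; applying these
     formulas twice gives the identity. *)
  have YE g r c : entry (g * Y) r c =
    (let a := entry g r i in let b := entry g r j in let d := entry g r k in
     if c == i then a + 2 * b + 2 * d else if c == j then - 2 * a - 3 * b - 2 * d
     else if c == k then 2 * a + 2 * b + d else entry g r c)%R.
    rewrite /Y !mulgA !(SE, VE) // ?eqxx ?(D _ _ ki) ?(D _ _ ji) ?(D _ _ kj) /=.
    case: (eqVneq c i) => [->|ci]; first by rewrite ?(D _ _ ki) ?(D _ _ ji); ring.
    case: (eqVneq c j) => [->|cj]; first by rewrite ?(D _ _ kj); ring.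
    by case: (eqVneq c k) => // ->; ring.
  apply: gamma_eq => g r c; rewrite expg2 mulgA mulg1 !YE ?eqxx.
  rewrite ?(D _ _ ki) ?(D _ _ ji) ?(D _ _ kj) /=.
  case: (eqVneq c i) => [->|_]; first ring.
  case: (eqVneq c j) => [->|_]; first ring.
  by case: (eqVneq c k) => // ->; ring.
Qed.

End GammaRelations.

(** * Peak reduction on the first row *)

Section Descent.
Variables (m : nat) (Q : groupType).
Variables (S : 'I_m.+1 -> 'I_m.+1 -> Q) (O : 'I_m.+1 -> Q) (phi : Q -> Gamma2 m.+1).
Hypotheses (n3 : m.+1 <= 3) (rel : relations3 S O) (phiM : {morph phi : x y / x * y}).
Hypothesis phiS : forall i j, i != j -> phi (S i j) = Sval (@gen_elt m.+1) i j.
Hypothesis phiO : forall i, phi (O i) = Oelt i.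
Implicit Types (x y g h o s : Q) (i j k l c : 'I_m.+1) (b : bool).

Lemma phi1 : phi 1 = 1.
Proof. by apply: (mulgI (phi 1)); rewrite -phiM !mulg1. Qed.

Lemma phiV x : phi x^-1 = (phi x)^-1.
Proof. by apply: (mulgI (phi x)); rewrite -phiM !mulgV phi1. Qed.

Definition Sg b i j := if b then (S i j)^-1 else S i j.

Definition toprow x c : int := entry (phi x) ord0 c.
Local Notation V := toprow.

Lemma SgN b i j : Sg (~~ b) i j = (Sg b i j)^-1.
Proof. by case: b; rewrite /= ?invgK. Qed.

Lemma toprow_S b x i j c : i != j -> V (x * Sg b i j) c =
  (if c == j then if b then V x c - 2 * V x i else V x c + 2 * V x i else V x c)%R.
Proof.
move=> ij; rewrite /toprow phiM; case: b => /=; last by rewrite phiS // entry_mulSval.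
by rewrite phiV phiS // entry_mulSvalV.
Qed.

Lemma toprow_O x i c : V (x * O i) c = (if c == i then - V x c else V x c)%R.
Proof. by rewrite /toprow phiM phiO entry_mulO. Qed.

Lemma toprow_1 c : V 1 c = (ord0 == c)%:R%R.
Proof. by rewrite /toprow phi1 entry1. Qed.

Lemma toprow_ext x y g : V x =1 V y -> V (x * g) =1 V (y * g).
Proof.
by move=> xy c; rewrite /toprow !phiM !entryM; apply: eq_bigr => k _; rewrite -/(V x k) xy.
Qed.

Lemma toprow_parity x c : exists z : int, V x c = ((ord0 == c)%:R + 2 * z)%R.
Proof. exact: entry_mod2. Qed.

Lemma toprow_even x c : c != ord0 -> exists z : int, V x c = (2 * z)%R.
Proof.
by move=> c0; have [z] := toprow_parity x c; rewrite eq_sym (negPf c0) add0r; exists z.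
Qed.

Lemma toprow_odd x : exists z : int, V x ord0 = (1 + 2 * z)%R.
Proof. by have [z] := toprow_parity x ord0; exists z. Qed.

(** The corner entry of [x * x^-1] is then the product of the corner entries of the two factors, so
    both are units of the integers. *)
Lemma toprow_unit x : (forall c, c != ord0 -> V x c = 0%R) ->
  V x ord0 = 1%R \/ V x ord0 = (-1)%R.
Proof.
move=> x0; have : entry (phi (x * x^-1)) ord0 ord0 = 1%R by rewrite mulgV phi1 entry1.
rewrite phiM entryM (bigD1 ord0) //= big1 => [|k k0]; last by rewrite -/(V x k) x0 // mul0r.
rewrite addr0 -/(V x ord0); move: (V x ord0) (entry _ _ _) => a b ab.
have : (`|a| * `|b|)%N = 1%N by rewrite -abszM ab.
by move/eqP; rewrite muln_eq1 => /andP[/eqP a1 _]; lia.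
Qed.

(** * The subgroup of generators fixing e_0 and its right cosets *)

Inductive fixgp : Q -> Prop :=
| fix1 : fixgp 1
| fixO i h of i != ord0 & fixgp h : fixgp (O i * h)
| fixS b i j h of i != j & i != ord0 & fixgp h : fixgp (Sg b i j * h).

Lemma fixM x y : fixgp x -> fixgp y -> fixgp (x * y).
Proof.
move=> fx fy; elim: fx => [|i h i0 _ IH|b i j h ij i0 _ IH]; first by rewrite mul1g.
- by rewrite -mulgA; apply: fixO.
- by rewrite -mulgA; apply: fixS.
Qed.

Lemma fixO1 i : i != ord0 -> fixgp (O i).
Proof. by move=> i0; rewrite -[O i]mulg1; apply/fixO/fix1. Qed.

Lemma fixS1 b i j : i != j -> i != ord0 -> fixgp (Sg b i j).
Proof. by move=> ij i0; rewrite -[Sg _ _ _]mulg1; apply/fixS/fix1. Qed.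

Lemma OV i : (O i)^-1 = O i.
Proof. by apply: mulg1_eq; apply: relO2 rel _. Qed.

Lemma fixV x : fixgp x -> fixgp x^-1.
Proof.
elim=> [|i h i0 _ IH|b i j h ij i0 _ IH]; first by rewrite invg1; apply: fix1.
- by rewrite invgM OV; apply/fixM/fixO1.
- by rewrite invgM -SgN; apply/fixM/fixS1.
Qed.

Lemma toprow_fix h : fixgp h -> V h =1 V 1.
Proof.
elim=> {h} // [i h i0 _ IH|b i j h ij i0 _ IH] c.
- rewrite -IH -[h in RHS]mul1g; apply: toprow_ext => {}c; rewrite -[O i]mul1g toprow_O toprow_1.
  by case: (eqVneq c i) => // ->; rewrite eq_sym (negPf i0).
- rewrite -IH -[h in RHS]mul1g; apply: toprow_ext => {}c; rewrite -[Sg _ _ _]mul1g toprow_S // !toprow_1.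
  by case: (eqVneq c j) => // _; rewrite [_ == i]eq_sym (negPf i0) mulr0; case: b; rewrite ?subr0 ?addr0.
Qed.

Lemma toprow_fixl h x : fixgp h -> V (h * x) =1 V x.
Proof. by move=> /toprow_fix hh c; rewrite (toprow_ext x hh) mul1g. Qed.

Definition rcos x y := fixgp (x / y).

Lemma rcos_sym x y : rcos x y -> rcos y x.
Proof. by move=> /fixV; rewrite invgF. Qed.

Lemma rcos_trans y x z : rcos x y -> rcos y z -> rcos x z.
Proof. by move=> xy /(fixM xy); rewrite divgKA. Qed.

Lemma rcosMr g x y : rcos x y -> rcos (x * g) (y * g).
Proof. by rewrite /rcos mulgKA. Qed.

(** The stabilizer, under right multiplication, of the right coset of [fixgp] containing [x]. It
    depends only on this coset ([stab_cos]) and is conjugated when [x] moves ([stab_conj]). *)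
Definition stab x g := rcos (x * g) x.

Lemma stabM x g h : stab x g -> stab x h -> stab x (g * h).
Proof. by move=> xg; apply: rcos_trans; rewrite mulgA; apply: rcosMr. Qed.

Lemma stabV x g : stab x g -> stab x g^-1.
Proof. by move=> /rcos_sym/(rcosMr g^-1); rewrite mulgK. Qed.

Lemma stab_cos x y g : rcos x y -> stab y g -> stab x g.
Proof.
move=> xy yg; apply: rcos_trans (rcosMr g xy) _.
exact: rcos_trans yg (rcos_sym xy).
Qed.

Lemma stab_conj x s g : stab x (s * g * s^-1) -> stab (x * s) g.
Proof. by move=> /(rcosMr s); rewrite /stab -!mulgA mulVg mulg1. Qed.

Lemma stab_comm x s g : s * g = g * s -> stab x g -> stab (x * s) g.
Proof. by move=> sg xg; apply: stab_conj; rewrite sg mulgK. Qed.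

(** * The l^1 norm of the first row and sign changes *)

Definition normrow x := (\sum_c `|V x c|)%N.
Local Notation N := normrow.

Lemma norm_ext x y : V x =1 V y -> N x = N y.
Proof. by move=> xy; apply: eq_bigr => c _; rewrite xy. Qed.

Lemma norm_S b i j x : i != j ->
  (N (x * Sg b i j) + `|V x j|)%N = (N x + `|V (x * Sg b i j) j|)%N.
Proof.
move=> ij; rewrite /normrow (bigD1 j) //= [in RHS](bigD1 j) //= addnAC.
rewrite [in RHS]addnAC [in RHS](addnC `|V x j|%N); congr (_ + _)%N.
by apply: eq_bigr => c cj; rewrite toprow_S // (negPf cj).
Qed.

Lemma norm_O i x : N (x * O i) = N x.
Proof. by apply: eq_bigr => c _; rewrite toprow_O; case: eqP => // _; rewrite abszN. Qed.

Lemma OSg k b i j : i != j ->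
  Sg b i j * O k = O k * Sg (b (+) ((k == i) || (k == j))) i j.
Proof.
move=> ij; have flip x : O k * x * O k = x^-1 -> x * O k = O k * x^-1 /\ x^-1 * O k = O k * x.
  move=> kx; have kx' : x * O k = O k * x^-1 by rewrite -kx -!mulgA -{2}(OV k) mulKg.
  split=> //; apply: (mulgI x); rewrite mulVKg mulgA kx' mulgVK //.
have comm x : O k * x = x * O k -> x * O k = O k * x /\ x^-1 * O k = O k * x^-1.
  by move=> kx; split=> //; apply: (mulgI x); rewrite mulVKg mulgA -kx mulgK.
case: (boolP ((k == i) || (k == j))) => [kij|/norP[ki kj]].
  have [|f1 f2] := flip (S i j).
    by case/orP: kij => /eqP ->; [apply: (relOSi rel ij)|apply: (relOSj rel ij)].
  by case: b; rewrite addbT.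
by have [f1 f2] := comm _ (relOS rel ki kj ij); case: b.
Qed.

Inductive signs : Q -> Prop :=
| signs1 : signs 1
| signsO i o of signs o : signs (O i * o).

Lemma signs_conj o : signs o -> forall b i j, i != j ->
  exists b', Sg b i j * o = o * Sg b' i j.
Proof.
elim=> [|k {}o _ IH] b i j ij; first by exists b; rewrite mulg1 mul1g.
rewrite mulgA OSg // -mulgA; set b1 := (_ (+) _).
by have [b2 ->] := IH b1 i j ij; exists b2; rewrite mulgA.
Qed.

Lemma signs_flip (A : pred 'I_m.+1) : exists2 o, signs o &
  forall x c, V (x * o) c = (if A c then - V x c else V x c)%R.
Proof.
have [s sA su] : exists2 s, uniq s & s =i A.
  by exists (enum A); [apply: enum_uniq|move=> c; rewrite mem_enum].
have [o so oE] : exists2 o, signs o &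
    forall x c, V (x * o) c = (if c \in s then - V x c else V x c)%R.
  elim: s {su} sA => [_|i s IH /= /andP[is_ /IH[o so oE]]].
    by exists 1; [apply: signs1|move=> x c; rewrite mulg1].
  exists (O i * o); first exact: signsO.
  move=> x c; rewrite mulgA oE toprow_O inE; case: (eqVneq c i) => //= ->.
  by rewrite (negPf is_).
by exists o => // x c; rewrite oE su.
Qed.

(** * Climbing elements *)

Inductive climb : Q -> Prop :=
| climb0 h of fixgp h : climb h
| climbO i x of climb x : climb (x * O i)
| climbS b i j x of i != j & climb x & (N x < N (x * Sg b i j))%N :
    climb (x * Sg b i j).

Lemma climb_fixl h x : fixgp h -> climb x -> climb (h * x).
Proof.
move=> fh; elim=> [h' fh'|i {}x _ IH|b i j {}x ij _ IH lt].
- by apply/climb0/fixM.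
- by rewrite mulgA; apply: climbO.
- rewrite mulgA; apply: climbS => //.
  by rewrite -mulgA (norm_ext (toprow_fixl x fh)) (norm_ext (toprow_fixl _ fh)).
Qed.

Lemma climb_cos x y : rcos x y -> climb y -> climb x.
Proof. by move=> xy /(climb_fixl xy); rewrite mulgVK. Qed.

Lemma climb_signs o x : signs o -> climb x -> climb (x * o).
Proof.
move=> so; elim: so x => [|i {}o _ IH] x cx; first by rewrite mulg1.
by rewrite mulgA; apply/IH/climbO.
Qed.

(** Entry 0 is odd and the others are even. So a nonzero entry away from 0 differs from entry 0 in
    absolute value, and changing the larger by twice the smaller lowers the norm. The descent ends
    at e_0 or -e_0; read backwards, it climbs. *)
Lemma climb_exists x : exists2 y, climb y & V y =1 V x.
Proof.
have [k] := ubnP (N x); elim: k x => // k IH x xk.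
case: (boolP [forall c, (c != ord0) ==> (V x c == 0%R)]) => [/forallP x0|].
  have {}x0 c : c != ord0 -> V x c = 0%R by move=> c0; have := x0 c; rewrite c0 => /eqP.
  have [x1|x1] := toprow_unit x0.
    exists 1; first exact/climb0/fix1.
    move=> c; rewrite toprow_1; case: (eqVneq c ord0) => [->|c0]; first by rewrite x1.
    by rewrite x0.
  exists (1 * O ord0); first exact/climbO/climb0/fix1.
  move=> c; rewrite toprow_O toprow_1; case: (eqVneq c ord0) => [->|c0]; first by rewrite x1.
  by rewrite x0.
rewrite negb_forall => /existsP[i]; rewrite negb_imply => /andP[i0 xi0].
have desc p q : p != q -> (0 < `|V x p|)%N -> (`|V x p| < `|V x q|)%N ->
    exists2 y, climb y & V y =1 V x.
  move=> pq p0 lt; pose b := (0 < V x p)%R (+) (0 < V x q)%R.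
  have := norm_S (~~ b) x pq; rewrite toprow_S // eqxx => E.
  have lt2 : (N (x * Sg (~~ b) p q) < N x)%N.
    by move: E; rewrite /b; case: (boolP (0 < V x p)%R); case: (boolP (0 < V x q)%R) => /=; lia.
  have [|y cy yx] := IH (x * Sg (~~ b) p q); first lia.
  have yE : V (y * Sg b p q) =1 V x.
    by move=> c; rewrite (toprow_ext _ yx) SgN mulgVK.
  exists (y * Sg b p q) => //; apply: climbS => //.
  by rewrite (norm_ext yE) (norm_ext yx).
have [z zE] := toprow_even x i0; have [t tE] := toprow_odd x.
case: (ltngtP `|V x i| `|V x ord0|)%N => h; last by lia.
- by apply: desc h => //; lia.
- by apply: desc h => //; [rewrite eq_sym|lia].
Qed.

(** Sign changes after the last strict step are gathered into the one factor [o]. *)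
Lemma climb_last x : climb x -> (exists2 h, fixgp h & exists2 o, signs o & x = h * o) \/
  exists b i j y o, [/\ i != j, climb y, (N y < N (y * Sg b i j))%N, signs o &
    x = y * Sg b i j * o].
Proof.
have sr o i : signs o -> signs (o * O i).
  elim=> [|k {}o _ IH]; last by rewrite -mulgA; apply: signsO.
  by rewrite mul1g -[O i]mulg1; apply/signsO/signs1.
elim=> [h fh|i {}x cx [[h fh [o so ->]]|[b [k [j [y [o [ij cy lt so ->]]]]]]]|b i j {}x ij cx _ lt].
- by left; exists h => //; exists 1; [apply: signs1|rewrite mulg1].
- by left; exists h => //; exists (o * O i); [apply: sr|rewrite mulgA].
- right; exists b, k, j, y, (o * O i); split=> //; [exact: sr|by rewrite mulgA].
- by right; exists b, i, j, x, 1; split=> //; [apply: signs1|rewrite mulg1].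
Qed.

(** * Relations between letters on at most three indices *)

Lemma ord_three i j k l : i != j -> i != k -> j != k -> [|| l == i, l == j | l == k].
Proof.
move: (ltn_ord i) (ltn_ord j) (ltn_ord k) (ltn_ord l).
by rewrite -!val_eqE /=; lia.
Qed.

Lemma Sg_comm b b' i j k l : S i j * S k l = S k l * S i j ->
  Sg b i j * Sg b' k l = Sg b' k l * Sg b i j.
Proof.
move=> c; have {}c : commute (Sg b i j) (S k l).
  by apply: commute_sym; case: b => /=; [apply: commuteV|]; apply: commute_sym.
by case: b' => //=; apply: commuteV.
Qed.

Lemma Scol b b' i j k : i != k -> j != k -> i != j ->
  Sg b i k * Sg b' j k = Sg b' j k * Sg b i k.
Proof. by move=> ik jk ij; apply/Sg_comm/(relScol rel). Qed.

Lemma Srow b b' i j k : i != j -> i != k -> j != k ->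
  Sg b i j * Sg b' i k = Sg b' i k * Sg b i j.
Proof. by move=> ij ik jk; apply/Sg_comm/(relSrow rel). Qed.

(** Relator (9) solved for a conjugate, for both signs; by (8) the square of [S i l] commutes with
    [S k l]. *)
Lemma Schain b i k l : i != k -> k != l -> i != l ->
  Sg b k l * S i k * (Sg b k l)^-1 = Sg (~~ b) i l ^+ 2 * S i k.
Proof.
move=> ik kl il; have := relSS rel ik kl il; rewrite /comm.
have c : commute (S k l) (S i l ^+ 2).
  by apply: commuteX; apply: (@Scol false false) => //; rewrite eq_sym.
move=> /(canRL (mulgVK _))/(canRL (mulgVK _)) E.
have {E}E : S i k * S k l = S k l * (S i l ^+ 2 * S i k) by rewrite mulgA c.
case: b => /=; first by rewrite invgK -mulgA E mulKg.
apply: (canLR (mulgK _)); rewrite expVgn -mulgA E [S k l * _]mulgA c -mulgA.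
by rewrite mulKg.
Qed.

(** Induction along the climb: conjugating [S i j] back over the last letter gives letters with the
    same first index [i], whose entry is 0 before that step as well. *)
Lemma stab_zero x i j : climb x -> V x i = 0%R -> i != j -> stab x (S i j).
Proof.
move=> cx; elim: cx i j => {x} [h fh|k x cx IH|b k l x kl cx IH lt] i j xi ij.
- have i0 : i != ord0.
    by apply/eqP => i0; move: xi; rewrite (toprow_fix fh) toprow_1 i0 eqxx.
  rewrite /stab /rcos; apply: fixM (fixV fh); apply: fixM => //.
  exact: (@fixS1 false).
- have xi0 : V x i = 0%R by move: xi; rewrite toprow_O; case: eqP => // _ /eqP; rewrite oppr_eq0 => /eqP.
  apply: stab_conj; rewrite OV.
  have := OSg k false ij => /= E; rewrite -mulgA E mulgA (relO2 rel) mul1g.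
  by case: ((k == i) || (k == j)) => /=; [apply: stabV|]; apply: IH.
- have E := norm_S b x kl; rewrite toprow_S // eqxx in E.
  (* A strict step neither uses an entry 0 as its source nor leaves 0 at its target. So [i], [k],
     [l] are different, and as there are at most three indices, [j] is [k] or [l]. *)
  have ki : k != i.
    apply/eqP => ki; subst i; move: xi; rewrite toprow_S // (negPf kl) => xk.
    by move: E lt; rewrite xk; case: (b); lia.
  have li : l != i.
    apply/eqP => li; subst i; move: xi E lt; rewrite toprow_S // eqxx => ->; lia.
  have xi0 : V x i = 0%R by move: xi; rewrite toprow_S // eq_sym (negPf li).
  have [ik il] : i != k /\ i != l by rewrite ![i == _]eq_sym.
  have /or3P[/eqP ji|/eqP jk|/eqP jl] := ord_three j ik il kl.
  + by rewrite ji eqxx in ij.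
  + subst j; apply: stab_conj; rewrite Schain //; apply: stabM; last exact: IH.
    have st : stab x (Sg (~~ b) i l).
      by case: (b); last apply: stabV; apply: IH.
    by rewrite expg2; apply: stabM.
  + subst j; apply: stab_comm; last exact: IH.
    exact: (@Scol b false).
Qed.

Lemma neq_eqF (p q r : 'I_m.+1) : p != q -> p != r -> q != r ->
  ((p == q) = false) * ((q == p) = false) * ((p == r) = false) *
  ((r == p) = false) * ((q == r) = false) * ((r == q) = false).
Proof.
move=> pq pr qr; rewrite [q == p]eq_sym [r == p]eq_sym [r == q]eq_sym.
by rewrite (negPf pq) (negPf pr) (negPf qr).
Qed.

Lemma Schain2 p q r : p != q -> q != r -> p != r ->
  Sg true p q * Sg false q r =
    Sg true p r * (Sg true p r * (Sg false q r * Sg true p q)).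
Proof.
move=> pq qr pr; have /(canRL (mulgVK _)) E := Schain false pq qr pr.
have c := @Srow true true p q r pq pr qr; rewrite /= expg2 in E c *.
apply: (mulIg (S p q)); rewrite -!mulgA mulVg mulg1 E -!mulgA.
by rewrite [LHS]mulgA c -mulgA [in LHS](mulgA (S p q)^-1) c -mulgA mulKg.
Qed.

Lemma norm_three p q r x : p != q -> p != r -> q != r ->
  N x = (`|V x p| + `|V x q| + `|V x r|)%N.
Proof.
move=> pq pr qr; rewrite /normrow (bigD1 p) //= (bigD1 q) 1?eq_sym //=.
rewrite (bigD1 r) /= ?big1 ?addn0 ?addnA //; last first.
  by rewrite ![r == _]eq_sym pr qr.
by move=> c; have /or3P[] := ord_three c pq pr qr => ->; rewrite ?andbF.
Qed.

(** Every [O i] except [O ord0] lies in [fixgp] and commutes with [O ord0], so only the parity of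
    the number of factors [O ord0] remains. *)
Lemma signs_split o : signs o ->
  exists o', [/\ fixgp o', O ord0 * o' = o' * O ord0 & o = o' \/ o = o' * O ord0].
Proof.
elim=> [|i {}o _ [o' [fo co oE]]].
  by exists 1; split; [apply: fix1|rewrite mulg1 mul1g|left].
case: (eqVneq i ord0) => [->|i0].
  exists o'; split=> //; case: oE => ->; first by right.
  by left; rewrite mulgA co -mulgA (relO2 rel) mulg1.
exists (O i * o'); split; first exact: fixO.
- by rewrite mulgA (relOO rel) 1?eq_sym // -!mulgA co.
- by case: oE => ->; [left|right; rewrite mulgA].
Qed.

Lemma norm_signs o x : signs o -> N (x * o) = N x.
Proof.
move=> so; elim: so x => [|i {}o _ IH] x; first by rewrite mulg1.
by rewrite mulgA IH norm_O.
Qed.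

(** The trailing signs are moved across the last strict step. On a nonnegative row that step must
    have added twice entry [i] to entry [j], so its inverse is a descent. *)
Lemma climb_last_pos x : climb x -> (forall c, (0 <= V x c)%R) -> fixgp x \/
  exists i j, [/\ i != j, climb (x * Sg true i j) & (0 < V x i < V x j)%R].
Proof.
move=> /climb_last[[h fh [o so xE]]|[b [i [j [y [o [ij cy lt so xE]]]]]]] pos.
  left; have [o' [fo _ oE]] := signs_split so; rewrite xE; case: oE => oE.
    by rewrite oE; apply: fixM.
  (* A remaining factor [O ord0] would make entry 0 equal to -1. *)
  have := pos ord0; rewrite xE (toprow_fixl _ fh) oE toprow_O eqxx (toprow_fix fo) toprow_1.
  by rewrite eqxx.
right; exists i, j; have [b' oE] := signs_conj so b ij.
rewrite -mulgA oE mulgA in xE; have cyo := climb_signs so cy.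
have Nx : (N (y * o) < N (y * o * Sg b' i j))%N.
  have -> : y * o * Sg b' i j = y * Sg b i j * o by rewrite -[in LHS]mulgA -oE mulgA.
  by rewrite !(norm_signs _ so).
move: (y * o) cyo xE Nx => z cz xE Nz.
have := norm_S b' z ij; have := pos j; have := pos i.
rewrite xE !toprow_S // eqxx (negPf ij).
case: (b') Nz xE => Nz xE zi zj E; first by exfalso; lia.
by split=> //; [rewrite (SgN false) mulgK|lia].
Qed.

(** * Reflections that fix the rows with two equal entries *)

Lemma OSgl i j b : i != j -> O i * Sg b i j = Sg (~~ b) i j * O i.
Proof. by move=> ij; rewrite OSg // eqxx /= addbT negbK. Qed.

Lemma OSgr i j b : i != j -> O j * Sg b i j = Sg (~~ b) i j * O j.
Proof. by move=> ij; rewrite OSg // eqxx orbT addbT negbK. Qed.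

Lemma OSgn i j k b : i != j -> k != i -> k != j -> O k * Sg b i j = Sg b i j * O k.
Proof. by move=> ij ki kj; rewrite OSg // (negPf ki) (negPf kj) addbF. Qed.

Section EqualPair.
Variables p q r : 'I_m.+1.
Hypotheses (pq : p != q) (pr : p != r) (qr : q != r).

Let qp : q != p. Proof. by rewrite eq_sym. Qed.
Let rp : r != p. Proof. by rewrite eq_sym. Qed.
Let rq : r != q. Proof. by rewrite eq_sym. Qed.

(** On rows v, [Sg true p q * O q] is the reflection replacing v_q by 2 v_p - v_q. It commutes with
    adding the same multiple of v_r to both entries; the proof derives this from the relations in
    [Q]. *)
Lemma pair_comm b : Sg b r q * Sg b r p * (Sg true p q * O q) =
  Sg true p q * O q * (Sg b r q * Sg b r p).
Proof.
have c : commute (Sg true p q * O q) (Sg false r q * Sg false r p).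
  rewrite /commute -!mulgA (mulgA (O q)) OSgr // -mulgA OSgn //=.
  rewrite (mulgA (Sg true p q)) (Scol true true) // -mulgA (mulgA (Sg true p q)).
  have /(canRL (mulgVK _)) /= -> := Schain true rp pq rq.
  by rewrite expg2 -!mulgA mulKg.
case: b; last exact: commute_sym.
rewrite (Srow true true) // -invgM; apply/esym/(@commuteV Q); exact: c.
Qed.

(** The reflection negates v_p - v_q, and [Sg false p r * Sg true q r] adds twice this difference to
    v_r, so it is inverted by the reflection; again this is derived in [Q]. *)
Lemma pair_flip : Sg true p q * O q * (Sg false p r * Sg true q r) =
  Sg true p r * Sg false q r * (Sg true p q * O q).
Proof.
rewrite -!mulgA (mulgA (O q)) OSgn // -mulgA OSgl //=.
rewrite (mulgA (Sg true p q)) (Srow true false) // -mulgA (mulgA (Sg true p q)).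
by rewrite Schain2 // -!mulgA /= mulVKg.
Qed.

End EqualPair.

Lemma pair_prod p q : p != q ->
  Sg true p q * O q * (Sg true q p * O p) = Sg true p q * Sg false q p * (O q * O p).
Proof.
by move=> pq; rewrite -!mulgA (mulgA (O q)) OSgl 1?eq_sym //= -!mulgA.
Qed.

(** By [pair_prod] the product of the two reflections is [u * (O q * O p)]. The second factor is an
    involution, and it commutes with [u] because each letter of [u] involves both [p] and [q] and is
    inverted twice. *)
Lemma pair_square p q : p != q -> let u := Sg true p q * Sg false q p in
  Sg true p q * O q * (Sg true q p * O p) * (Sg true p q * O q * (Sg true q p * O p)) =
  u * u.
Proof.
move=> pq u; have qp : q != p by rewrite eq_sym.
rewrite pair_prod // -/u.
have c : O q * O p * u = u * (O q * O p).
  rewrite /u -!mulgA (mulgA (O p)) OSgl // -!mulgA OSgr //.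
  by rewrite (mulgA (O q)) OSgr // -!mulgA (mulgA (O q)) OSgl // -!mulgA.
have w2 : O q * O p * (O q * O p) = 1.
  by rewrite -mulgA (mulgA (O p)) (relOO rel pq) -mulgA (relO2 rel) mulg1 (relO2 rel).
move: c w2; move: u (O q * O p) => v w c w2.
by rewrite -mulgA (mulgA w) c -mulgA w2 mulg1.
Qed.

(** Moving [u] to the right in the square gives g t g^-1 t^-1 u^2 = 1, the first conclusion.
    Conjugating it by [u] and inverting gives the second. *)
Lemma twist_algebra (g t u : Q) : u * g = g^-1 * u -> u * t = t^-1 * u ->
  (g * t * u) ^+ 2 = 1 ->
  g * t * g^-1 = (u * u)^-1 * t /\ g^-1 * t * g = t * (u * u).
Proof.
move=> mg mt gtu; have E : g * (t * (g^-1 * (t^-1 * (u * u)))) = 1.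
  by move: gtu; rewrite expg2 -!mulgA (mulgA u g) mg -!mulgA (mulgA u t) mt -!mulgA.
have E1 : g * t * g^-1 = (u * u)^-1 * t.
  apply: (mulIg (t^-1 * (u * u))); rewrite -!mulgA E.
  by rewrite mulVKg mulVg.
split=> //.
have gV : u * g^-1 = g * u by apply: (mulgI g^-1); rewrite mulKg mulgA -mg mulgK.
have L : u * (g * t * g^-1) = g^-1 * t^-1 * g * u.
  by rewrite !mulgA mg -(mulgA _ u t) mt !mulgA -(mulgA _ u) gV !mulgA.
have H : g^-1 * t^-1 * g = (u * u)^-1 * t^-1.
  apply: (mulIg u); rewrite -L E1 -(mulgA _ t^-1) -mt invgM.
  by rewrite -!mulgA mulVKg mulKg.
by have := congr1 (fun z => z^-1) H; rewrite /= !invgM !invgK mulgA.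
Qed.

(** Relator (10) is used here. To apply [twist_algebra], [u] must invert [g] and [t]: the product
    [u * (O q * O p)] of two reflections commutes with both, while [O q * O p] inverts both. *)
Lemma pair_twist p q b : p != ord0 -> q != ord0 -> p != q ->
  let t := S p ord0 * (S q ord0)^-1 in
  let u := Sg true p q * Sg false q p in
  Sg b ord0 q * Sg b ord0 p * t * (Sg b ord0 q * Sg b ord0 p)^-1 =
    if b then t * (u * u) else (u * u)^-1 * t.
Proof.
move=> p0 q0 pq t u.
have qp : q != p by rewrite eq_sym.
have [op oq] : ord0 != p /\ ord0 != q by rewrite ![ord0 == _]eq_sym.
set g := Sg false ord0 q * Sg false ord0 p.
have gE : g = Sg false ord0 p * Sg false ord0 q by apply: Srow.
have tE : t = Sg true q ord0 * Sg false p ord0 by apply: (@Scol false true).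
have tV : t^-1 = Sg true p ord0 * Sg false q ord0.
  by rewrite tE invgM /= invgK.
have gV : g^-1 = Sg true ord0 q * Sg true ord0 p by rewrite gE invgM.
have wo z : O q * O p * (z * (O q * O p)) = O q * O p * z * (O q * O p) by rewrite mulgA.
have og : O q * O p * g = g^-1 * (O q * O p).
  rewrite gV /g -!mulgA (mulgA (O p)) OSgn // -!mulgA OSgr //.
  by rewrite (mulgA (O q)) OSgr // -!mulgA (mulgA (O q)) OSgn // -!mulgA.
have ot : O q * O p * t = t^-1 * (O q * O p).
  rewrite tV /t -[S p ord0]/(Sg false p ord0) -[(S q ord0)^-1]/(Sg true q ord0).
  rewrite -!mulgA (mulgA (O p)) OSgl // -!mulgA OSgn //.
  by rewrite (mulgA (O q)) OSgn // -!mulgA (mulgA (O q)) OSgl // -!mulgA.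
have ABg : g * (u * (O q * O p)) = u * (O q * O p) * g.
  have A1 := pair_comm pq p0 q0 false; have B1 := pair_comm qp q0 p0 false.
  rewrite -/g in A1; rewrite -gE in B1.
  by rewrite -pair_prod // mulgA A1 -mulgA B1 mulgA.
have ABt : u * (O q * O p) * t = t * (u * (O q * O p)).
  have A1 := pair_flip pq p0 q0; have B1 := pair_flip qp q0 p0.
  rewrite -tV -/t in A1; rewrite (@Scol false true) // -tV -tE in B1.
  have At : Sg true p q * O q * t^-1 = t * (Sg true p q * O q).
    by apply: (mulgI t^-1); rewrite mulKg mulgA -A1 mulgK.
  have Bt : Sg true q p * O p * t = t^-1 * (Sg true q p * O p).
    by apply: (mulgI t); rewrite mulVKg mulgA -B1 mulgVK.
  by rewrite -pair_prod // -mulgA Bt !mulgA At !mulgA.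
have inv_of z : O q * O p * z = z^-1 * (O q * O p) -> z * (u * (O q * O p)) = u * (O q * O p) * z ->
    u * z = z^-1 * u.
  move=> oz; rewrite -(mulgA u) oz (mulgA u z^-1) (mulgA z u) => /mulIg zu.
  by apply: (mulgI z); rewrite mulVKg mulgA zu mulgVK.
have [|E1 E2] := @twist_algebra g t u (inv_of _ og ABg) (inv_of _ ot (esym ABt)).
  (* Conjugation by [O q] inverts exactly the letters involving [q], which turns [g * t * u] into
     the word of relator (10). *)
  have W : O q * (g * t * u) = S ord0 p * (S ord0 q)^-1 * S q ord0 * S p ord0 *
      S p q * (S q p)^-1 * O q.
    rewrite gE tE /u -!mulgA (mulgA (O q)) OSgn // -!mulgA (mulgA (O q)) OSgr //.
    rewrite -!mulgA (mulgA (O q)) (OSgl true) // -!mulgA (mulgA (O q)) (OSgn false) //.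
    by rewrite -!mulgA (mulgA (O q)) (OSgr true) // -!mulgA (OSgl false).
  have := relsq rel op oq pq; rewrite !expg2; move: W; set w := _ * _^-1 => W ww.
  clearbody w; rewrite -[g * t * u](mulKg (O q)) W OV !mulgA -(mulgA (O q * w)).
  by rewrite (relO2 rel) mulg1 -(mulgA (O q)) ww mulg1 (relO2 rel).
case: b; last exact: E1.
by rewrite (Srow true true) // -invgM invgK.
Qed.

(** * Simultaneous induction on the norm *)

Definition coset_unique M := forall x y, climb x -> climb y -> N x = M ->
  V x =1 V y -> rcos x y.

Definition climb_flat M := forall b i j x, i != j -> climb x -> N x = M ->
  N (x * Sg b i j) = M -> climb (x * Sg b i j).

(* As matrices, both elements fix every row whose entries [p] and [q] agree. *)
Definition equal_stab M := forall x p q, p != ord0 -> q != ord0 -> p != q ->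
  climb x -> N x = M -> V x p = V x q ->
  stab x ((S p q)^-1 * O q) /\ stab x (S p ord0 * (S q ord0)^-1).

Section Step.
Variable M : nat.
Hypothesis uniqM : forall d, (d < M)%N -> coset_unique d.
Hypothesis flatM : forall d, (d < M)%N -> climb_flat d.
Hypothesis equalM : forall d, (d < M)%N -> equal_stab d.

(** If the norm drops, a climbing element over the new row climbs back to the row of [x], and
    uniqueness at the norm of [x] identifies the cosets. Steps that keep the norm are the subject of
    [climb_flat]. *)
Lemma climb_step b i j x : i != j -> climb x -> N x < M ->
  N (x * Sg b i j) < M -> climb (x * Sg b i j).
Proof.
move=> ij cx Nx NxS; case: (ltngtP (N x) (N (x * Sg b i j))) => [lt|gt|eq].
- exact: climbS.
- have [y cy yV] := climb_exists (x * Sg b i j).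
  have yE : V (y * Sg (~~ b) i j) =1 V x.
    by move=> c; rewrite (toprow_ext _ yV) SgN mulgK.
  have cyS : climb (y * Sg (~~ b) i j).
    by apply: climbS => //; rewrite (norm_ext yE) (norm_ext yV).
  apply: (climb_cos (y := y)) => //.
  have /(rcosMr (Sg b i j)) : rcos x (y * Sg (~~ b) i j).
    by apply: (uniqM Nx cx cyS) => // c; rewrite yE.
  by rewrite SgN mulgVK.
- by apply: (flatM Nx ij cx) => //; rewrite -eq.
Qed.

(** Subtractions of entry [p] from the two others commute by (6). Performing both and undoing the
    first joins the two descents through rows of norm below [M]. *)
Lemma row_transfer (p q r : 'I_m.+1) x : p != q -> p != r -> q != r -> N x = M ->
  (0 < V x p < V x q)%R -> (V x p < V x r)%R ->
  climb (x * Sg true p q) -> climb (x * Sg true p r).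
Proof.
move=> pq pr qr NM /andP[p0 pltq] pltr c1.
have D := neq_eqF pq pr qr.
have xE : x * Sg true p q * Sg true p r * Sg false p q = x * Sg true p r.
  by rewrite -!mulgA (Srow true false) ?D //= mulKg.
have N3 := norm_three _ pq pr qr.
have c2 : climb (x * Sg true p q * Sg true p r).
  by apply: climb_step => //; rewrite -NM !N3 !toprow_S // ?(eqxx, D); lia.
rewrite -xE; apply: climb_step => //.
  by rewrite -NM !N3 !toprow_S // ?(eqxx, D); lia.
by rewrite xE -NM !N3 !toprow_S // ?(eqxx, D); lia.
Qed.

(** From the row of x S_qr^-1 the letters S_pr, S_pq^-1, S_qr, S_pq lead to x S_pr^-1, by [Schain2]
    and (8). Entry [r] takes the values v_r - 2 v_q, v_r - 2 v_q + 2 v_p and v_r - 2 v_p, and all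
    norms stay below [M]. *)
Lemma col_transfer (p q r : 'I_m.+1) x : p != q -> p != r -> q != r -> N x = M ->
  (0 < V x p < V x q)%R -> (V x q < V x r)%R ->
  climb (x * Sg true q r) -> climb (x * Sg true p r).
Proof.
move=> pq pr qr NM /andP[p0 pltq] qltr c1.
have D := neq_eqF pq pr qr.
have N3 := norm_three _ pq pr qr.
have c2 : climb (x * Sg true q r * Sg false p r).
  by apply: climb_step => //; rewrite -NM !N3 !toprow_S // ?(eqxx, D); lia.
have c3 : climb (x * Sg true q r * Sg false p r * Sg true p q).
  by apply: climb_step => //; rewrite -NM !N3 !toprow_S // ?(eqxx, D); lia.
have x4 : x * Sg true q r * Sg false p r * Sg true p q * Sg false q r
    = x * Sg true p r * Sg true p q.
  rewrite -!mulgA Schain2 //; congr (x * _); rewrite /= mulVKg.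
  by rewrite mulgA (@Scol true true q p) ?D //= -mulgA mulKg.
have x5 : x * Sg true p r * Sg true p q * Sg false p q = x * Sg true p r.
  exact: mulgVK.
have c4 : climb (x * Sg true q r * Sg false p r * Sg true p q * Sg false q r).
  apply: climb_step => //; rewrite -NM; first by rewrite !N3 !toprow_S // ?(eqxx, D); lia.
  by rewrite x4 !N3 !toprow_S // ?(eqxx, D); lia.
rewrite x4 in c4; rewrite -x5; apply: climb_step => //; rewrite -NM.
  by rewrite !N3 !toprow_S // ?(eqxx, D); lia.
by rewrite x5 !N3 !toprow_S // ?(eqxx, D); lia.
Qed.

(** Both descents reach the same row and differ by S_p0 S_q0^-1, which stabilizes the coset by
    [equal_stab] at the smaller norm. *)
Lemma equal_transfer p q x : p != ord0 -> q != ord0 -> p != q -> N x = M ->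
  V x p = V x q -> (0 < V x p < V x ord0)%R ->
  climb (x * Sg true p ord0) -> climb (x * Sg true q ord0).
Proof.
move=> p0 q0 pq NM pEq /andP[px xo] c1.
have D := neq_eqF pq p0 q0; have N3 := norm_three _ pq p0 q0.
have lt : N (x * Sg true p ord0) < M.
  by rewrite -NM !N3 !toprow_S // ?(eqxx, D); lia.
have [|_] := equalM lt p0 q0 pq c1 erefl; first by rewrite !toprow_S // ?(eqxx, D).
by rewrite /stab mulgA mulgVK => /climb_cos; apply.
Qed.

(** Descents by the same letter are compared by uniqueness below [M] ([same]). Two different
    descents share their source, share their target or are consecutive, since there are at most
    three indices; a transfer then makes the letters agree. *)
Lemma descents_cos x y i j k l : N x = M -> V x =1 V y ->
  i != j -> k != l -> climb (x * Sg true i j) -> climb (y * Sg true k l) ->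
  (0 < V x i < V x j)%R -> (0 < V x k < V x l)%R -> rcos x y.
Proof.
move=> NM xy ij kl cx cy xij xkl.
have norm_desc p q z : p != q -> N z = M -> (0 < V z p < V z q)%R -> N (z * Sg true p q) < M.
  move=> pq zM zpq; have := norm_S true z pq; rewrite toprow_S // eqxx; lia.
have same z w p q : p != q -> N z = M -> V z =1 V w -> climb (z * Sg true p q) ->
    climb (w * Sg true p q) -> (0 < V z p < V z q)%R -> rcos z w.
  move=> pq zM zw cz cw zpq; have lt := norm_desc p q z pq zM zpq.
  have := uniqM lt cz cw erefl (toprow_ext _ zw); move/(rcosMr (Sg false p q)).
  by rewrite !mulgVK.
have NyM : N y = M by rewrite -(norm_ext xy).
(* Consecutive descents are compared through the common descent (p, r). *)
have chain z w p q r : p != q -> q != r -> N z = M -> N w = M -> V z =1 V w ->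
    climb (z * Sg true p q) -> climb (w * Sg true q r) ->
    (0 < V z p < V z q)%R -> (0 < V z q < V z r)%R -> rcos z w.
  move=> pq qr zM wM zw cz cw zpq zqr.
  have pr : p != r by apply/eqP => pr; subst r; lia.
  have wpq : (0 < V w p < V w q)%R by rewrite -!zw.
  have wqr : (0 < V w q < V w r)%R by rewrite -!zw.
  apply: (same z w p r) => //; last lia.
  - by apply: (row_transfer pq pr qr zM zpq _ cz); lia.
  - by apply: (col_transfer pq pr qr wM wpq _ cw); lia.
have ykl : (0 < V y k < V y l)%R by rewrite -!xy.
have yij : (0 < V y i < V y j)%R by rewrite -!xy.
case: (eqVneq k i) => [ki|ki]; [subst k; case: (eqVneq l j) => [lj|lj]|].
- by subst l; apply: (same x y i j).
- apply: (same x y i l) => //.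
  have jl : j != l by rewrite eq_sym.
  by apply: (row_transfer ij kl jl NM xij _ cx); case/andP: xkl.
case: (eqVneq l j) => [lj|lj]; first (subst l).
  have ik : i != k by rewrite eq_sym.
  case: (ltngtP `|V x i| `|V x k|) => h.
  - apply: (same x y i j) => //; by apply: (col_transfer ik ij kl NyM _ _ cy); rewrite -!xy; lia.
  - apply: (same x y k j) => //; by apply: (col_transfer ki kl ij NM _ _ cx); lia.
  have pz p z : p = ord0 -> exists t : int, V z p = (1 + 2 * t)%R.
    by move=> ->; apply: toprow_odd.
  (* Equal entries have equal parity and only entry 0 is odd, so neither [i] nor [k] is 0. The
     common target [j] is therefore 0, as [equal_transfer] requires. *)
  have i0 : i != ord0.
    apply/eqP => i0; have [t xi] := pz i x i0.
    have [|u xk] := toprow_even x (c := k); first by rewrite -i0.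
    by lia.
  have k0 : k != ord0.
    apply/eqP => k0; have [t xk] := pz k x k0.
    by have [u xi] := toprow_even x i0; lia.
  have j0 : j = ord0.
    have jk : j != k by rewrite eq_sym.
    have /or3P[/eqP E|/eqP E|/eqP E] := ord_three ord0 ij ik jk; last by rewrite E eqxx in k0.
      by rewrite E eqxx in i0.
    by rewrite E.
  subst j; apply: (same x y k ord0) => //.
  apply: (equal_transfer i0 k0 ik) => //; lia.
have kj : k = j \/ l = i.
  case: (eqVneq k j) => [|kj]; [by left|right].
  have jk : j != k by rewrite eq_sym.
  have ik : i != k by rewrite eq_sym.
  have /or3P[/eqP //|/eqP E|/eqP E] := ord_three l ij ik jk.
    by rewrite E eqxx in lj.
  by rewrite E eqxx in kl.
case: kj => [kj|li]; [subst k|subst l].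
- exact: (chain x y i j l).
- by apply/rcos_sym/(chain y x k i j) => // c; rewrite xy.
Qed.

(** After a sign change the row is nonnegative, so each element lies in [fixgp] or ends with a
    descent. The row e_0 admits no descent, so the same alternative holds for both. *)
Lemma coset_unique_step : coset_unique M.
Proof.
move=> x y cx cy NM xy.
have [o so oE] := signs_flip (fun c => (V x c < 0)%R).
suff : rcos (x * o) (y * o) by move/(rcosMr o^-1); rewrite !mulgK.
have pos c : (0 <= V (x * o) c)%R by rewrite oE; case: ifP; lia.
have xyo : V (x * o) =1 V (y * o) by apply: toprow_ext.
have NMo : N (x * o) = M by rewrite norm_signs.
have zero_desc h z i j : fixgp h -> V h =1 V z -> (0 < V z i < V z j)%R -> False.
  move=> fh hz; rewrite -!hz !(toprow_fix fh) !toprow_1.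
  by case: eqP; case: eqP => // _ _; lia.
have yx : V (y * o) =1 V (x * o) by move=> c; rewrite xyo.
case: (climb_last_pos (climb_signs so cx)) => // [fx|[i [j [ij cxi xij]]]].
  case: (climb_last_pos (climb_signs so cy)) => // [c|fy|[k [l [kl cyk ykl]]]].
  - by rewrite -xyo.
  - exact: fixM fx (fixV fy).
  - by case: (zero_desc _ _ _ _ fx xyo ykl).
case: (climb_last_pos (climb_signs so cy)) => // [c|fy|[k [l [kl cyk ykl]]]].
- by rewrite -xyo.
- by case: (zero_desc _ _ _ _ fy yx xij).
- by apply: (descents_cos NMo xyo ij kl) => //; rewrite !xyo.
Qed.

(** The row is lowered in a way that keeps entries [p] and [q] equal: by one letter changing entry 0
    if that entry is the larger in absolute value, otherwise by two letters changing entries [p] and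
    [q] alike. The stabilizing elements are then conjugated back. *)
Lemma equal_stab_step : equal_stab M.
Proof.
move=> x p q p0 q0 pq cx NM pEq; set a := (S p q)^-1 * O q; set t := S p ord0 * _.
have qp : q != p by rewrite eq_sym.
have D := neq_eqF pq p0 q0; have N3 := norm_three _ pq p0 q0.
have uniq z w : climb z -> climb w -> N z = M -> V z =1 V w -> rcos z w.
  exact: coset_unique_step.
have [z0 x0E] := toprow_odd x; have [z1 xpE] := toprow_even x p0.
case: (eqVneq (V x p) 0%R) => [xp|xp].
  have xq : V x q = 0%R by rewrite -pEq.
  split; first apply: stabM.
  - by apply/stabV/stab_zero.
  - apply: uniq => //; [exact: climbO|by rewrite norm_O|move=> c].
    by rewrite toprow_O; case: eqP => // ->; rewrite xq oppr0.
  - by apply: stabM; [|apply: stabV]; apply: stab_zero.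
case: (ltngtP `|V x p|%N `|V x ord0|%N) => [lt|gt|]; last by lia.
- pose b := (0 < V x p)%R (+) (0 < V x ord0)%R.
  have lt1 : N (x * Sg (~~ b) p ord0) < N x.
    rewrite !N3 !toprow_S // ?(eqxx, D).
    by rewrite /b; case: (boolP (0 < V x p)%R); case: (boolP (0 < V x ord0)%R) => /=; lia.
  have [y cy yV] := climb_exists (x * Sg (~~ b) p ord0).
  have yE : V (y * Sg b p ord0) =1 V x.
    by move=> c; rewrite (toprow_ext _ yV) SgN mulgVK.
  have ltM : N y < M by rewrite (norm_ext yV) -NM.
  have cyS : climb (y * Sg b p ord0).
    by apply: climbS => //; rewrite (norm_ext yE) (norm_ext yV).
  have xy : rcos x (y * Sg b p ord0) by apply: uniq.
  have [|ya yt] := equalM ltM p0 q0 pq cy erefl; first by rewrite !yV !toprow_S // ?(eqxx, D).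
  split; apply: stab_cos xy _; apply: stab_comm => //.
  (* The letter between [p] and 0 commutes with both elements, by (5), (6) and (8). *)
  + have E := @Srow b true p ord0 q p0 pq; rewrite eq_sym q0 in E.
    rewrite /= in E; rewrite /a mulgA E // -!mulgA; congr (_ * _).
    by have := OSg q b p0; rewrite (negPf qp) (negPf q0) addbF.
  + rewrite /t mulgA (@Sg_comm b false) // -!mulgA; congr (_ * _).
    exact: (@Scol b true p q ord0).
- pose b := (0 < V x p)%R (+) (0 < V x ord0)%R.
  pose y0 := x * Sg (~~ b) ord0 p * Sg (~~ b) ord0 q.
  have o0 c : c != ord0 -> ord0 != c by rewrite eq_sym.
  have lt1 : N y0 < N (x * Sg (~~ b) ord0 p) < N x.
    rewrite /y0 !N3 !toprow_S ?o0 // ?(eqxx, D).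
    by rewrite /b; case: (boolP (0 < V x p)%R); case: (boolP (0 < V x ord0)%R) => /=; lia.
  have [lt2 lt3] := andP lt1.
  have [y cy yV] := climb_exists y0.
  have ltM : N y < M by rewrite (norm_ext yV) -NM; lia.
  have yE1 : V (y * Sg b ord0 q) =1 V (x * Sg (~~ b) ord0 p).
    by move=> c; rewrite (toprow_ext _ yV) /y0 !SgN mulgVK.
  have yE : V (y * Sg b ord0 q * Sg b ord0 p) =1 V x.
    by move=> c; rewrite (toprow_ext _ yE1) SgN mulgVK.
  have cy1 : climb (y * Sg b ord0 q).
    by apply: climbS; rewrite ?o0 // (norm_ext yE1) (norm_ext yV).
  have cyS : climb (y * Sg b ord0 q * Sg b ord0 p).
    by apply: climbS; rewrite ?o0 // (norm_ext yE) (norm_ext yE1).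
  have xy := uniq _ _ cx cyS NM (fsym yE).
  have yq : V y p = V y q by rewrite !yV /y0 !toprow_S ?o0 // ?(eqxx, D) pEq.
  have [ya yt] := equalM ltM p0 q0 pq cy erefl yq.
  have [yb _] := equalM ltM q0 p0 qp cy erefl (esym yq).
  rewrite -mulgA in xy; split; apply: stab_cos xy _.
  + by apply: stab_comm => //; apply: pair_comm.
  (* By [pair_twist] the conjugate of [t] is [t] times a power of u^2, and u^2 stabilizes the coset
     of [y] because it is the square of the product of the two reflections. *)
  + apply: stab_conj; have st := stabM ya yb; have := stabM st st.
    rewrite pair_square // => ym.
    rewrite pair_twist //; case: (b) => /=.
    * by apply: stabM => //; apply: stabM.
    * by apply: stabM => //; apply: stabV.
Qed.

(** The norm is kept only if entry [i] is 0 or entry [j] is entry [i] up to sign; by parity, in the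
    second case neither index is 0. If the entries agree, the letter is a reflection times [O j]; if
    they are opposite, [O j] is applied first. *)
Lemma flat_step : climb_flat M.
Proof.
move=> b i j x ij cx NM NS; have := norm_S b x ij; rewrite NS NM => /addnI.
rewrite toprow_S // eqxx => E.
case: (eqVneq (V x i) 0%R) => [xi|xi].
  have st : stab x (Sg b i j) by case: (b); [apply: stabV|]; apply: stab_zero.
  exact: climb_cos st cx.
have ji : V x j = (if b then V x i else - V x i)%R by move: E; case: (b); lia.
have i0 : i != ord0.
  apply/eqP => i0; have [t xt] := toprow_odd x; rewrite -i0 in xt.
  have [|u xu] := toprow_even x (c := j); first by rewrite -i0 eq_sym.
  by move: ji; case: (b); lia.
have j0 : j != ord0.
  apply/eqP => j0; have [t xt] := toprow_odd x; rewrite -j0 in xt.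
  have [u xu] := toprow_even x i0.
  by move: ji; case: (b); lia.
case: b ji {NS E} => ji /=.
  have [st _] := equal_stab_step i0 j0 ij cx NM (esym ji).
  have := climbO j (climb_cos st cx).
  by rewrite mulgA -!mulgA (relO2 rel) mulg1.
have cxO := climbO j cx; have NMO : N (x * O j) = M by rewrite norm_O.
have [|st _] := equal_stab_step i0 j0 ij cxO NMO.
  by rewrite !toprow_O (negPf ij) eqxx ji opprK.
have := climb_cos st cxO; have /= E := OSg j true ij.
by rewrite -mulgA E eqxx orbT /= (mulgA (O j)) (relO2 rel) mul1g.
Qed.

End Step.

(** The three statements support each other: uniqueness at [M] uses [equal_stab] below [M], and at
    norm [M] it yields [equal_stab], which yields [climb_flat]. *)
Lemma climb_induction M : [/\ coset_unique M, climb_flat M & equal_stab M].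
Proof.
have [d] := ubnP M; elim: d M => // d IH M Md.
have IH' e : (e < M)%N -> [/\ coset_unique e, climb_flat e & equal_stab e].
  by move=> eM; apply: IH; lia.
split; [apply: coset_unique_step|apply: flat_step|apply: equal_stab_step];
  by move=> e /IH'[].
Qed.

Lemma climb_mulS b i j x : i != j -> climb x -> climb (x * Sg b i j).
Proof.
(* Any bound above both norms will do. *)
move=> ij cx; apply: (@climb_step (N x + N (x * Sg b i j)).+1) => //; try lia.
- by move=> e _; case: (climb_induction e).
- by move=> e _; case: (climb_induction e).
Qed.

Lemma climb_fix x : climb x -> V x =1 V 1 -> fixgp x.
Proof.
move=> cx x1; have [uniq _ _] := climb_induction (N x).
by have := uniq x 1 cx (climb0 fix1) erefl x1; rewrite /rcos divg1.
Qed.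

End Descent.

(** * The stabilizer of the first basis row *)

Section Stabilizer.
Variables (m : nat) (Q : groupType).
Variables (S : 'I_m.+1 -> 'I_m.+1 -> Q) (O : 'I_m.+1 -> Q) (phi : Q -> Gamma2 m.+1).
Hypotheses (n3 : m.+1 <= 3) (rel : relations3 S O) (phiM : {morph phi : x y / x * y}).
Hypothesis phiS : forall i j, i != j -> phi (S i j) = Sval (@gen_elt m.+1) i j.
Hypothesis phiO : forall i, phi (O i) = Oelt i.
Implicit Types (x y g h u : Q) (b : bool) (w : free_group (gen m)).

Local Notation up := (lift ord0).
Local Notation Sg := (Sg S).

Lemma entry_Sg b x i j r c : i != j -> entry (phi (x * Sg b i j)) r c =
  (if c == j then
     if b then entry (phi x) r c - 2 * entry (phi x) r i
     else entry (phi x) r c + 2 * entry (phi x) r i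
   else entry (phi x) r c)%R.
Proof.
move=> ij; rewrite phiM; case: b => /=; last by rewrite phiS // entry_mulSval.
by rewrite (phiV phiM) phiS // entry_mulSvalV.
Qed.

Lemma up0 (i : 'I_m) : up i != ord0.
Proof. by rewrite eq_sym neq_lift. Qed.

Lemma up_eq (i j : 'I_m) : (up i == up j) = (i == j).
Proof. exact: (inj_eq lift_inj). Qed.

(* The unipotent radical of the stabilizer of the first basis row. *)
Inductive trans : Q -> Prop :=
| trans1 : trans 1
| transS b (i : 'I_m) u of trans u : trans (u * Sg b (up i) ord0).

Lemma transM u v : trans u -> trans v -> trans (u * v).
Proof.
move=> tu; elim=> [|b i {}v _ IH]; first by rewrite mulg1.
by rewrite mulgA; apply: transS.
Qed.

Lemma trans_gen b i : trans (Sg b (up i) ord0).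
Proof. by rewrite -[Sg _ _ _]mul1g; apply/transS/trans1. Qed.

Lemma transV u : trans u -> trans u^-1.
Proof.
elim=> [|b i {}u _ IH]; first by rewrite invg1; apply: trans1.
by rewrite invgM -SgN; apply: transM IH; apply: trans_gen.
Qed.

Lemma trans_conj g u : (forall b i, trans (g * Sg b (up i) ord0 * g^-1)) ->
  trans u -> trans (g * u * g^-1).
Proof.
move=> gS; elim=> [|b i {}u _ IH]; first by rewrite mulg1 mulgV; apply: trans1.
have -> : g * (u * Sg b (up i) ord0) * g^-1 =
    (g * u * g^-1) * (g * Sg b (up i) ord0 * g^-1) by rewrite !mulgA mulgVK.
exact: transM.
Qed.

(** Exponents are natural numbers; a general translation is a quotient of two such products, see
    [trans_normal]. *)
Definition tprod (p : 'I_m -> nat) : Q := \prod_i S (up i) ord0 ^+ p i.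

Lemma trans_comm i j : commute (S (up i) ord0) (S (up j) ord0).
Proof.
case: (eqVneq i j) => [->|ij] //.
by apply: (relScol rel); rewrite ?up0 // up_eq.
Qed.

Lemma tprodS p i :
  tprod (fun k => (k == i) + p k)%N = S (up i) ord0 * tprod p.
Proof.
rewrite /tprod; under eq_bigr => k _ do rewrite expgnDr.
rewrite prodgM_commute => [|k l _ _]; last exact/commuteX2/trans_comm.
rewrite (big_only1 i) // ?eqxx ?expg1 // => k ki _.
by rewrite (negPf ki).
Qed.

Lemma tprod_comm p i : commute (S (up i) ord0) (tprod p).
Proof. by apply: commute_prod => k _; apply/commuteX/trans_comm. Qed.

Definition trans_coord u (v : 'I_m -> int) := forall r c, entry (phi u) r c =
  (if c == ord0 then if unlift ord0 r is Some i then 2 * v i else 1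
   else (r == c)%:R)%R.

Lemma trans_coord1 : trans_coord 1 (fun=> 0%R).
Proof.
move=> r c; rewrite (phi1 phiM) entry1; case: unliftP => [i ->|->].
  by case: (eqVneq c ord0) => // ->; rewrite (negPf (up0 i)) mulr0.
by rewrite eq_sym; case: (c == ord0).
Qed.

Lemma trans_coordS b i u v : trans_coord u v ->
  trans_coord (u * Sg b (up i) ord0)
    (fun k => v k + (if b then -1 else 1) *+ (k == i))%R.
Proof.
move=> uv r c; rewrite entry_Sg ?up0 // !uv (negPf (up0 i)).
case: (eqVneq c ord0) => // _; case: unliftP => [k ->|->]; last first.
  by rewrite (negPf (neq_lift _ _)) mulr0; case: (b); rewrite ?subr0 ?addr0.
by rewrite up_eq; case: (b) => /=; case: (k == i) => /=; lia.
Qed.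

Lemma trans_normal u : trans u -> exists p q : 'I_m -> nat,
  u = tprod p / tprod q /\ trans_coord u (fun i => (p i)%:Z - (q i)%:Z)%R.
Proof.
elim=> [|b i {}u _ [p [q [uE uv]]]].
  exists (fun=> 0), (fun=> 0); split; first by rewrite mulgV.
  exact: trans_coord1.
exists (if b then p else fun k => ((k == i) + p k)%N).
exists (if b then fun k => ((k == i) + q k)%N else q); split.
  have c1 := commuteV (tprod_comm q i).
  rewrite uE; case: (b); rewrite /= tprodS; first by rewrite invgM -mulgA.
  by rewrite -mulgA -c1 mulgA tprod_comm.
have := trans_coordS b i uv; congr trans_coord; apply/funext => k.
by case: (b) => /=; case: (k == i) => /=; lia.
Qed.

(** In the form of [trans_normal], column 0 displays 2 (p - q), so its vanishing off the corner
    forces [p = q]. Thus translations in [Q] are detected by their matrices. *)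
Lemma trans_trivial u : trans u ->
  (forall r, entry (phi u) r ord0 = (r == ord0)%:R%R) -> u = 1.
Proof.
move=> /trans_normal[p [q [-> uE]]] u0.
suff -> : p = q by rewrite mulgV.
apply/funext => i; have := u0 (up i); rewrite uE eqxx liftK (negPf (up0 i)); lia.
Qed.

Lemma trans_coord_onto (v : 'I_m -> int) : exists2 u, trans u & trans_coord u v.
Proof.
suff [u tu uv] : exists2 u, trans u &
    trans_coord u (fun k => if k \in enum 'I_m then v k else 0%R).
  by exists u => //; move: uv; congr trans_coord; apply/funext => k; rewrite mem_enum.
elim: (enum 'I_m) (enum_uniq 'I_m) => [_|i s IH /= /andP[is_ /IH[u tu uv]]].
  by exists 1; [apply: trans1|apply: trans_coord1].
have step b d : exists2 u', trans u' & trans_coord u'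
    (fun k => (if k \in s then v k else 0) + (if b then -1 else 1) *+ d *+ (k == i))%R.
  elim: d => [|d [u' tu' uv']].
    exists u => //; move: uv; congr trans_coord; apply/funext => k.
    by rewrite mulr0n mul0rn addr0.
  exists (u' * Sg b (up i) ord0); first exact: transS.
  have := trans_coordS b i uv'; congr trans_coord; apply/funext => k.
  by rewrite mulrSr mulrnDl addrA.
have [u' tu' uv'] := step (v i < 0)%R `|v i|%N.
exists u' => //; move: uv'; congr trans_coord; apply/funext => k.
rewrite inE; case: (eqVneq k i) => [->|ki] /=; last by rewrite mulr0n addr0.
by rewrite (negPf is_); case: (boolP (v i < 0)%R); lia.
Qed.

(** * The Levi factor, generated by the letters avoiding index 0 *)

Definition levi : free_group (gen m) -> Q :=
  fglift (gen_val (fun i j => S (up i) (up j)) (fun i => O (up i))).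

Lemma levi_relations : relations3 (fun i j => S (up i) (up j)) (fun i => O (up i)).
Proof.
case: rel => r1 r2 r3 r4 r5 r6 r7 r8 r9.
by split=> *; [apply: r1|apply: r2|apply: r3|apply: r4|apply: r5|apply: r6|
  apply: r7|apply: r8|apply: r9]; rewrite up_eq.
Qed.

(** The matrix of [x] is block diagonal with blocks 1 and [y]. *)
Definition levi_rel x (y : Gamma2 m) :=
  [/\ forall i j, entry (phi x) (up i) (up j) = entry y i j,
      forall r, entry (phi x) r ord0 = (r == ord0)%:R%R &
      forall c, entry (phi x) ord0 c = (ord0 == c)%:R%R].

Lemma levi_relS b i j x (y : Gamma2 m) (z := Sval (@gen_elt m) i j) : i != j -> levi_rel x y ->
  levi_rel (x * Sg b (up i) (up j)) (y * (if b then z^-1 else z)).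
Proof.
move=> ij [xy xc xr]; have uij : up i != up j by rewrite up_eq.
split=> [k l|r|c]; rewrite entry_Sg //.
- by rewrite !xy up_eq /z; case: (b); rewrite ?entry_mulSval // entry_mulSvalV.
- by rewrite [_ == up j]eq_sym (negPf (up0 _)) xc.
- rewrite !xr [_ == up i]eq_sym (negPf (up0 i)) mulr0.
  by case: (b); rewrite ?subr0 ?addr0; case: (c == _).
Qed.

Lemma levi_relO i x (y : Gamma2 m) : levi_rel x y -> levi_rel (x * O (up i)) (y * Oelt i).
Proof.
move=> [xy xc xr]; split=> [k l|r|c]; rewrite phiM phiO entry_mulO.
- by rewrite !xy up_eq entry_mulO.
- by rewrite [_ == up i]eq_sym (negPf (up0 _)) xc.
- by rewrite xr; case: (eqVneq c (up i)) => // ->; rewrite [_ == up i]eq_sym (negPf (up0 _)) oppr0.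
Qed.

Lemma levi_entry w : levi_rel (levi w) (fglift (@gen_elt m) w).
Proof.
rewrite (gen_valE (@gen_elt m)) /levi /fglift.
elim/last_ind: (fgword w) => [|s [[[[i j] ij]|i] b] IH].
- by rewrite !big_nil; split=> *; rewrite (phi1 phiM) ?entry1 // up_eq.
- by rewrite -!cats1 !big_cat !big_seq1; apply: levi_relS.
- rewrite -!cats1 !big_cat !big_seq1 /letter_eval /= (OV rel).
  have -> : (Oelt i)^-1 = Oelt i by apply: mulg1_eq; apply: (relO2 (gamma_relations m)).
  by rewrite !if_same; apply: levi_relO.
Qed.

(** A generator of [fixgp] is either a translation or a Levi letter, and Levi letters normalize the
    translations, so the translations can be collected on the left. *)
Lemma fixgp_split h : fixgp S O h -> exists u w, trans u /\ h = u * levi w.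
Proof.
have leviS b i j : i != j -> exists w, levi w = Sg b (up i) (up j).
  move=> ij; pose g := Sgen ij.
  have gE : levi g = S (up i) (up j) by rewrite /levi fglift_gen.
  exists (if b then g^-1 else g); case: b => //=.
  by rewrite /levi gmulfV -gE.
have leviO i : exists w, levi w = O (up i).
  by exists (Ogen i); rewrite /levi fglift_gen.
have leviM v w : levi (v * w) = levi v * levi w by apply: fglift_mul.
have push g u w0 w : levi w0 = g -> (forall b i, trans (g * Sg b (up i) ord0 * g^-1)) ->
    trans u -> exists u' w', trans u' /\ g * (u * levi w) = u' * levi w'.
  move=> gE gS tu; exists (g * u * g^-1), (w0 * w); split; first exact: trans_conj.
  by rewrite leviM gE !mulgA mulgVK.
elim=> [|i {}h i0 _ [u [w [tu ->]]]|b i j {}h ij i0 _ [u [w [tu ->]]]].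
- exists 1, 1; split; first exact: trans1.
  by rewrite /levi fglift1 mulg1.
- case: (unliftP ord0 i) i0 => [k ->|->] // _.
  have [w0 w0E] := leviO k; apply: push w0E _ tu => b l.
  rewrite (OV rel) -mulgA OSg ?up0 // mulgA (relO2 rel) mul1g.
  exact: trans_gen.
case: (unliftP ord0 i) i0 ij => [k ->|->] // _; case: (unliftP ord0 j) => [l ->|->] ij.
  rewrite up_eq in ij; have [w0 w0E] := leviS b k l ij; apply: push w0E _ tu => b' r.
  have kl : up k != up l by rewrite up_eq.
  have [rk|rk] := eqVneq r k.
    rewrite rk (Srow rel) ?up0 // mulgK; exact: trans_gen.
  have [rl|rl] := eqVneq r l; last first.
    have /or3P[/eqP|/eqP|/eqP] := ord_three n3 (up r) (neq_lift ord0 k) (neq_lift ord0 l) kl.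
    - by move/eqP; rewrite (negPf (up0 r)).
    - by move/eqP; rewrite up_eq (negPf rk).
    - by move/eqP; rewrite up_eq (negPf rl).
  subst r.
  (* By (9) the conjugate acquires two translation letters in direction [up k]. *)
  have E : Sg b (up k) (up l) * S (up l) ord0 * (Sg b (up k) (up l))^-1 =
      Sg b (up k) ord0 * Sg b (up k) ord0 * S (up l) ord0.
    case: (b); last first.
      by have := relSS rel kl (up0 l) (up0 k) => /(canRL (mulgVK _)); rewrite expg2.
    by rewrite [_ * S (up l) ord0](Schain2 rel kl (up0 l) (up0 k)) !mulgA mulgK.
  have tE : trans (Sg b (up k) (up l) * S (up l) ord0 * (Sg b (up k) (up l))^-1).
    rewrite E; apply: transM; last exact: (@trans_gen false).
    by apply: transM; apply: trans_gen.
  case: b' => //=; move: (transV tE).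
  by rewrite invgM invgM invgK mulgA.
exists (Sg b (up k) ord0 * u), w; split; last by rewrite mulgA.
by apply: transM tu; apply: trans_gen.
Qed.

Hypothesis IH : is_presentation (@gen_elt m) (@relators3 m).

(** Column 0 of the inverse of the Levi part is that of the identity, so the translation part has
    trivial matrix and is 1. The Levi part then comes from a word trivial in size [m], and the
    relators of size [m] hold for the shifted letters. *)
Lemma fixgp_trivial h : fixgp S O h -> phi h = 1 -> h = 1.
Proof.
move=> /fixgp_split[u [w [tu ->]]]; rewrite phiM => uw1.
have leviV : levi w^-1 = (levi w)^-1 by rewrite /levi gmulfV.
have u1 : u = 1.
  apply: trans_trivial tu _ => r; have [_ wc _] := levi_entry w^-1.
  by rewrite -wc leviV (phiV phiM); congr entry; apply: (mulIg (phi (levi w))); rewrite uw1 mulVg.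
have {uw1} w1 : phi (levi w) = 1 by rewrite -uw1 u1 (phi1 phiM) mul1g.
have [we _ _] := levi_entry w.
have /IH.2 wn : fglift (@gen_elt m) w = 1.
  by apply: entry_inj => i j; rewrite -we w1 !entry1 up_eq.
rewrite u1 mul1g; apply: normal_closure_lift wn; exact/relators3P/levi_relations.
Qed.

End Stabilizer.

(** * Induction on the size *)

Section Induction.
Variable m : nat.
Hypotheses (n3 : m.+1 <= 3) (IH : is_presentation (@gen_elt m) (@relators3 m)).

Local Notation up := (lift ord0).

(** By [climb_mulS] the value of every word climbs. If its matrix is trivial, its first row is e_0,
    so [climb_fix] puts it in [fixgp], where [fixgp_trivial] applies. *)
Lemma lift_trivial (Q : groupType) (f : gen m.+1 -> Q) (phi : Q -> Gamma2 m.+1) w :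
  {morph phi : x y / x * y} -> (forall x, phi (f x) = gen_elt x) ->
  (forall r, relators3 r -> fglift f r = 1) ->
  fglift (@gen_elt m.+1) w = 1 -> fglift f w = 1.
Proof.
rewrite (gen_valE f); set S := Sval f; set O := fun i => f (inr i).
move=> phiM phif /relators3P rel w1.
have phiO i : phi (O i) = Oelt i by apply: (phif (inr i)).
have phiS i j : i != j -> phi (S i j) = Sval (@gen_elt m.+1) i j.
  by move=> ij; rewrite Sval_neq; apply: (phif (inl (exist _ (i, j) ij))).
have phiw : phi (fglift (gen_val S O) w) = fglift (@gen_elt m.+1) w.
  rewrite /fglift; elim/last_ind: (fgword w) => [|s [x b] IHs].
    by rewrite !big_nil (phi1 phiM).
  rewrite -!cats1 !big_cat !big_seq1 phiM IHs /letter_eval; congr (_ * _).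
  by case: b => /=; rewrite ?(phiV phiM) phif.
have cw : climb S O phi (fglift (gen_val S O) w).
  rewrite /fglift; elim/last_ind: (fgword w) => [|s [[[[i j] ij]|i] b] IHs].
  - by rewrite big_nil; apply/climb0/fix1.
  - by rewrite -cats1 big_cat big_seq1; apply: (climb_mulS n3 rel phiM phiS phiO b).
  - rewrite -cats1 big_cat big_seq1 /letter_eval /= (OV rel) if_same.
    exact: climbO.
apply: (fixgp_trivial n3 rel phiM phiS phiO IH); last by rewrite phiw.
apply: (climb_fix n3 rel phiM phiS phiO cw) => c.
by rewrite /toprow phiw w1 (phi1 phiM).
Qed.

(** * Surjectivity *)

Definition generated (g : Gamma2 m.+1) := exists w, fglift (@gen_elt m.+1) w = g.

Lemma generatedM g h : generated g -> generated h -> generated (g * h).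
Proof. by move=> [v <-] [w <-]; exists (v * w); rewrite gmulfM. Qed.

Lemma generatedV g : generated g -> generated g^-1.
Proof. by move=> [v <-]; exists v^-1; rewrite gmulfV. Qed.

Lemma generatedO i : generated (Oelt i).
Proof. by exists (Ogen i); rewrite fglift_gen. Qed.

Let S := Sval (@gen_elt m.+1).
Let O := @Oelt m.+1.

Lemma generatedS b i j : i != j -> generated (Sg S b i j).
Proof.
move=> ij; have gS : generated (S i j).
  by exists (Sgen ij); rewrite fglift_gen /S Sval_neq.
by case: b => //; apply: generatedV.
Qed.

Lemma generated1 : generated 1.
Proof. by exists 1; rewrite gmulf1. Qed.

Lemma generated_climb g : climb S O id g -> generated g.
Proof.
elim=> [h|i x _ gx|b i j x ij _ gx _]; last 2 first.
- by apply: generatedM gx _; apply: generatedO.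
- by apply: generatedM gx _; apply: generatedS.
elim=> [|i {}h _ _ gh|b i j {}h ij _ _ gh]; first exact: generated1.
- by apply: generatedM gh; apply: generatedO.
- by apply: generatedM gh; apply: generatedS.
Qed.

Let rel : relations3 S O := @gamma_relations m.+1.

Lemma generated_trans u : trans S u -> generated u.
Proof.
elim=> [|b i {}u _ gu]; first exact: generated1.
by apply: generatedM gu _; apply: generatedS; apply: up0.
Qed.

Lemma generated_levi w : generated (levi S O w).
Proof.
rewrite /levi /fglift; elim/last_ind: (fgword w) => [|s [[[[i j] ij]|i] b] IHs].
- by rewrite big_nil; apply: generated1.
- rewrite -cats1 big_cat big_seq1; apply: generatedM IHs _.
  by apply: (generatedS b); rewrite up_eq.
- rewrite -cats1 big_cat big_seq1; apply: generatedM IHs _.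
  by case: b; [apply: generatedV|]; apply: generatedO.
Qed.

(** Such a matrix is a translation times a Levi element: the lower right block lies in the level 2
    group of size [m], generated by the induction hypothesis, and column 0 determines the
    translation. *)
Lemma generated_fix (g : Gamma2 m.+1) :
  (forall c, entry g ord0 c = (ord0 == c)%:R%R) -> generated g.
Proof.
move=> g0.
(* The inverse also has first row e_0, so the lower right blocks of [g] and [g^-1] are inverse to
   each other. *)
have gV0 c : entry g^-1 ord0 c = (ord0 == c)%:R%R.
  rewrite -entry1 -(mulgV g) entryM (bigD1 ord0) //= g0 mul1r big1 ?addr0 // => k k0.
  by rewrite g0 eq_sym (negPf k0) mul0r.
pose A (h : Gamma2 m.+1) : 'M[int]_m := (\matrix_(i, j) entry h (up i) (up j))%R.
have AM : (A g *m A (g^-1)%g = 1%:M)%R.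
  apply/matrixP => i j; rewrite !mxE; have := entry1 (up i) (up j).
  rewrite -(mulgV g) entryM big_ord_recl gV0 (negPf (neq_lift _ _)) mulr0 add0r.
  by rewrite up_eq => <-; apply: eq_bigr => k _; rewrite !mxE.
have [Au _] := mulmx1_unit AM.
have A2 : MkGL Au \in @ker_mod2 m.
  rewrite inE -val_eqE /=; apply/eqP/matrixP => i j; rewrite !mxE.
  have [z ->] := entry_mod2 g (up i) (up j); rewrite up_eq.
  have two0 : (2%:~R = 0 :> 'Z_2)%R by apply/val_inj.
  by rewrite rmorphD rmorphM /= two0 mul0r addr0; case: (i == j).
have [w wE] := IH.1 (MkGamma2 A2).
pose v i := (entry g (up i) ord0 %/ 2)%Z.
have vE i : entry g (up i) ord0 = (2 * v i)%R.
  by rewrite /v; have [z ->] := entry_mod2 g (up i) ord0; rewrite (negPf (up0 i)) add0r mulKz.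
have phiM : {morph (id : Gamma2 m.+1 -> Gamma2 m.+1) : x y / x * y} by [].
have [u tu uv] := @trans_coord_onto m _ S id n3 phiM (fun i j _ => erefl) v.
have [le lc lr] := @levi_entry m _ S O id rel phiM (fun i j _ => erefl) (fun i => erefl) w.
suff -> : g = u * levi S O w.
  by apply: generatedM; [apply: generated_trans|apply: generated_levi].
apply: entry_inj => r c; rewrite entryM.
have -> : (\sum_k entry u r k * entry (levi S O w) k c =
    entry u r ord0 * (ord0 == c)%:R + \sum_(k < m) (r == up k)%:R * entry (levi S O w) (up k) c)%R.
  rewrite big_ord_recl lr; congr (_ + _)%R; apply: eq_bigr => k _.
  by rewrite uv (negPf (up0 k)).
rewrite uv eqxx; case: (unliftP ord0 r) => [i ->|->].
  rewrite (bigD1 i) //= eqxx mul1r big1 ?addr0 => [|k ki]; last first.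
    by rewrite up_eq eq_sym (negPf ki) mul0r.
  case: (unliftP ord0 c) => [j ->|->].
    by rewrite mulr0 add0r le wE /entry /= mxE.
  by rewrite lc (negPf (up0 i)) addr0 mulr1 vE.
rewrite g0 mul1r big1 ?addr0 // => k _.
by rewrite (negPf (neq_lift _ _)) mul0r.
Qed.

(** The matrix group itself serves as [Q], with [phi] the identity. A climbing [y] with the first
    row of [g] is generated, and [g / y] has first row e_0. *)
Lemma generated_all (g : Gamma2 m.+1) : generated g.
Proof.
have [y cy yg] := climb_exists (O := O) (S := S) (phi := id) n3 (fun _ _ => erefl) (fun _ _ _ => erefl) (fun _ => erefl) g.
rewrite -(mulgVK y g); apply: generatedM; last exact: generated_climb.
apply: generated_fix => c.
have := toprow_ext (phi := id) (fun _ _ => erefl) y^-1 yg c.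
by rewrite /toprow mulgV entry1 => ->.
Qed.

Lemma presentation_step : is_presentation (@gen_elt m.+1) (@relators3 m.+1).
Proof.
apply: presentation_from_quotients => [||Q f phi phiM phif fR w]; first exact: generated_all.
- by rewrite (gen_valE (@gen_elt m.+1)); apply/relators3P/gamma_relations.
- exact: lift_trivial.
Qed.

End Induction.

(** * The presentations for n = 3 and n = 2 *)

Lemma presentation3 n : n <= 3 -> is_presentation (@gen_elt n) (@relators3 n).
Proof.
elim: n => [_|m IH n3]; last by apply: presentation_step => //; apply/IH/ltnW.
(* Size 0: there are no generators, and both groups are trivial. *)
have gen0 (P : Prop) : gen 0 -> P by case=> [[[[]]]|[]].
split=> [g|w]; first by exists 1; apply: entry_inj => -[].
have -> : w = 1 by case: w => [[|[x b] s] r]; [apply/val_inj|apply: gen0 x].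
by split=> _; [apply: ncl_one|apply: gmulf1].
Qed.

(** Relators (5) to (10) involve three different indices, and ['I_2] has only two elements. *)
Lemma relators3_2 : @relators3 2 = @relators2 2.
Proof.
have no3 (i j k : 'I_2) : i != j -> i != k -> j != k -> False.
  by move: (ltn_ord i) (ltn_ord j) (ltn_ord k); rewrite -!val_eqE /=; lia.
apply/funext => r; apply/propext; split; last exact: rel_relators2.
case=> // i j k *; exfalso; apply: (no3 i j k) => //; by rewrite eq_sym.
Qed.

Theorem proposition1p2 :
  is_presentation (@gen_elt 2) (@relators2 2) /\
  is_presentation (@gen_elt 3) (@relators3 3).
Proof. by rewrite -relators3_2; split; apply: presentation3. Qed.
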